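(* Let $H$ be a reproducing kernel Hilbert space with bounded measurable kernel $k$ on a measurable space $(X,\mathcal A)$ and let $\mu$ be a finite measure on the $\sigma$-algebra $\mathcal A$ such that $\mathcal A$ is $\mu$-complete and $$e_n\bigl(I_{k,\mu}:H\to L_2(\mu)\bigr)\asymp n^{-1/\alpha}$$ for some $\alpha\in(0,2)$. In addition, assume that for some $\beta\in(\alpha/2,1]$ the interpolation space $[L_2(\mu),[H]_\sim]_{\beta,2}$ is compactly embedded into $L_\infty(\mu)$ with $$e_n\bigl([L_2(\mu),[H]_\sim]_{\beta,2}\hookrightarrow L_\infty(\mu)\bigr)\prec n^{-\beta/\alpha}.$$ Then $$e_n\bigl([L_2(\mu),[H]_\sim]_{\gamma,2}\hookrightarrow L_\infty(\mu)\bigr)\asymp e_n\bigl([L_2(\mu),[H]_\sim]_{\gamma,2}\hookrightarrow L_2(\mu)\bigr)\asymp n^{-\gamma/\alpha}$$ for all $\gamma\in[\beta,1]$, and $$e_n\bigl(I_{k,\mu}:H\to L_\infty(\mu)\bigr)\asymp n^{-1/\alpha}.$$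
   Context: For a Banach space $E$, $B_E$ denotes its closed unit ball. For sequences $(a_n)_{n\ge1},(b_n)_{n\ge1}$ of nonnegative reals, $a_n\prec b_n$ means that there is a constant $c\in(0,\infty)$ with $a_n\le c\,b_n$ for all $n\ge1$; $a_n\asymp b_n$ means $a_n\prec b_n$ and $b_n\prec a_n$. Entropy numbers: for a bounded linear operator $T:E\to F$ between Banach spaces and $n\ge1$, $e_n(T):=\inf\{\varepsilon>0:\exists\,x_1,\dots,x_{2^{n-1}}\in F \text{ with } TB_E\subset\bigcup_{i=1}^{2^{n-1}}(x_i+\varepsilon B_F)\}$. The notation $E\hookrightarrow F$ means that $E\subset F$ with continuous inclusion, and $e_n(E\hookrightarrow F)$ is the entropy number of this inclusion map; $E$ is compactly embedded into $F$ if $E\subset F$ and the inclusion is compact. $H$ is a Hilbert space of real-valued functions on $X$, and $I_{k,\mu}:H\to L_p(\mu)$ is the map $I_{k,\mu}f:=[f]_\sim$, where $[f]_\sim$ is the $\mu$-equivalence class of $f$. The space $[H]_\sim:=\{[f]_\sim:f\in H\}\subset L_2(\mu)$ carries the quotient norm $\|g\|_{[H]_\sim}:=\inf\{\|f\|_H:f\in H,\ [f]_\sim=g\}$. ''$\mathcal A$ is $\mu$-complete'' means that every subset of a $\mu$-null set belongs to $\mathcal A$. For $\theta\in(0,1)$, $[L_2(\mu),[H]_\sim]_{\theta,2}$ denotes the real interpolation space: with $K(g,t):=\inf\{\|g-h\|_{L_2(\mu)}+t\|h\|_{[H]_\sim}:h\in[H]_\sim\}$, it consists of all $g\in L_2(\mu)$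 with $\|g\|_{\theta,2}:=\bigl(\int_0^\infty (t^{-\theta}K(g,t))^2\,\tfrac{dt}{t}\bigr)^{1/2}<\infty$. For $\theta=1$ the convention $[L_2(\mu),[H]_\sim]_{1,2}:=[H]_\sim$ is used. *)

(* Defs.v *)
From HB Require Import structures.
From mathcomp Require Import all_boot all_order all_algebra.
From mathcomp Require Import all_classical all_reals all_analysis.
From mathcomp Require Import measurable_realfun ess_sup_inf.

Set Implicit Arguments.
Unset Strict Implicit.
Unset Printing Implicit Defensive.

Import Order.TTheory GRing.Theory Num.Def Num.Theory.
Import numFieldNormedType.Exports.

Local Open Scope classical_set_scope.
Local Open Scope ring_scope.

(** The library provides the type [LspaceType mu p1] of classes modulo almost
    everywhere equality of measurable functions with finite [p]-norm (where
    [p1 : 1 <= p]), but not its structure of normed space, which is built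
    first. *)

Section Lspace_class.
Context d (X : measurableType d) (R : realType).
Variables (mu : {measure set X -> \bar R}) (p : \bar R) (p1 : (1 <= p)%E).

Lemma Lnorm_ae_eq (f g : X -> R) :
  measurable_fun [set: X] f -> measurable_fun [set: X] g ->
  f = g %[ae mu] -> 'N[mu]_p[EFin \o f]%E = 'N[mu]_p[EFin \o g]%E.
Proof.
move=> mf mg fg; rewrite unlock /Lnorm; case: p p1 => [r _|_|//].
  congr (_ `^ _)%E; apply: ae_eq_integral => //=.
  - apply/measurable_EFinP.
    apply: (@measurableT_comp _ _ _ _ _ _ (@powR R ^~ r)) => //.
    exact: measurableT_comp.
  - apply/measurable_EFinP.
    apply: (@measurableT_comp _ _ _ _ _ _ (@powR R ^~ r)) => //.
    exact: measurableT_comp.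
  by apply: filterS fg => x /(_ I) fg _ /=; rewrite fg.
case: ifP => // _; apply: eq_ess_sup.
by apply: filterS fg => x /(_ I) /= ->.
Qed.

Definition mfun_class (f : {mfun X >-> measurableTypeR R}) :
    {mfun_ mu, X >-> measurableTypeR R} := (\pi f)%qT.

Lemma mfun_class_eq (f g : {mfun X >-> measurableTypeR R}) :
  mfun_class f = mfun_class g <-> f = g %[ae mu].
Proof.
split.
  by move/eqmodP => /asboolP.
by move=> fg; apply/eqmodP/asboolP.
Qed.

Lemma mfun_classE (f : {mfun X >-> measurableTypeR R}) :
  (mfun_class f : X -> R) = f %[ae mu].
Proof. by apply/mfun_class_eq; rewrite /mfun_class reprK. Qed.

Section class.
Variables (f : X -> R) (Lf : f \in Lfun mu p).

Definition mfun_of_Lfun : {mfun X >-> measurableTypeR R} :=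
  @mfun_Sub _ _ X (measurableTypeR R) f (sub_Lfun_mfun Lf).

Let fin : finite_norm mu p (mfun_class mfun_of_Lfun).
Proof.
rewrite /finite_norm (Lnorm_ae_eq _ _ (mfun_classE mfun_of_Lfun)).
- exact: (set_mem (sub_Lfun_finLfun Lf)).
- exact: (@measurable_funPT _ _ X (measurableTypeR R)).
- exact: (@measurable_funPT _ _ X (measurableTypeR R)).
Qed.

HB.instance Definition _ :=
  @isFinLebesgue.Build d X R mu p p1 (mfun_class mfun_of_Lfun) fin.

Definition Lclass_of : LspaceType mu p1 := (mfun_class mfun_of_Lfun).

Lemma Lclass_ofE : (Lclass_of : X -> R) = f %[ae mu].
Proof. exact: mfun_classE. Qed.
End class.

Lemma Lspace_Lfun (g : LspaceType mu p1) : (g : X -> R) \in Lfun mu p.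
Proof.
rewrite inE; apply/andP; split; rewrite inE/=.
  exact: (@measurable_funPT _ _ X (measurableTypeR R)).
exact: Lebesgue_finite.
Qed.

Lemma Lspace_eqP (g h : LspaceType mu p1) : g = h <-> (g : X -> R) = h %[ae mu].
Proof.
split=> [->|gh]; first exact: ae_eq_refl.
case: g h gh => [g [[gf]]] [h [[hf]]] /= gh.
have gh' : g = h.
  by rewrite -[g]reprK -[h]reprK; apply/mfun_class_eq.
by subst h; rewrite (Prop_irrelevance gf hf).
Qed.


End Lspace_class.

Arguments Lclass_of {d X R mu p} p1 {f}.

Section Lspace_normed.
Context d (X : measurableType d) (R : realType).
Variables (mu : {measure set X -> \bar R}) (p : \bar R) (p1 : (1 <= p)%E).
Local Notation Lp := (LspaceType mu p1).
Implicit Types f g h : Lp.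

Lemma Lfun_add (f g : X -> R) : f \in Lfun mu p -> g \in Lfun mu p ->
  f \+ g \in Lfun mu p.
Proof. exact: (Lfun_addr_closed mu p1).2. Qed.

Lemma Lfun_opp (f : X -> R) : f \in Lfun mu p -> \- f \in Lfun mu p.
Proof. exact: Lfun_oppr_closed. Qed.

Lemma Lfun_scaler (a : R) (f : X -> R) : f \in Lfun mu p ->
  a \*: f \in Lfun mu p.
Proof.
have [H0 H] := Lfun_submod_closed mu p1.
by move=> Lf; have := H a _ _ Lf H0; rewrite addr0.
Qed.

Definition Lspace_zero : Lp := Lclass_of p1 (Lfun_submod_closed mu p1).1.
Definition Lspace_opp f : Lp := Lclass_of p1 (Lfun_opp (Lspace_Lfun f)).
Definition Lspace_add f g : Lp :=
  Lclass_of p1 (Lfun_add (Lspace_Lfun f) (Lspace_Lfun g)).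
Definition Lspace_scale (a : R) f : Lp :=
  Lclass_of p1 (Lfun_scaler a (Lspace_Lfun f)).

Let addE f g : (Lspace_add f g : X -> R) = (f : X -> R) \+ g %[ae mu].
Proof. exact: Lclass_ofE. Qed.
Let oppE f : (Lspace_opp f : X -> R) = \- (f : X -> R) %[ae mu].
Proof. exact: Lclass_ofE. Qed.
Let scaleE a f : (Lspace_scale a f : X -> R) = a \*: (f : X -> R) %[ae mu].
Proof. exact: Lclass_ofE. Qed.
Let zeroE : (Lspace_zero : X -> R) = cst 0 %[ae mu].
Proof. exact: Lclass_ofE. Qed.

Let addA : associative Lspace_add.
Proof.
move=> f g h; apply/Lspace_eqP; near=> x => _.
rewrite (near (addE f (Lspace_add g h)) x)//= (near (addE g h) x)//=.
rewrite (near (addE (Lspace_add f g) h) x)//= (near (addE f g) x)//=.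
by rewrite addrA.
Unshelve. all: by end_near. Qed.

Let addC : commutative Lspace_add.
Proof.
move=> f g; apply/Lspace_eqP; near=> x => _.
by rewrite (near (addE f g) x)// (near (addE g f) x)//= addrC.
Unshelve. all: by end_near. Qed.

Let add0 : left_id Lspace_zero Lspace_add.
Proof.
move=> f; apply/Lspace_eqP; near=> x => _.
by rewrite (near (addE Lspace_zero f) x)//= (near zeroE x)//= add0r.
Unshelve. all: by end_near. Qed.

Let addN : left_inverse Lspace_zero Lspace_opp Lspace_add.
Proof.
move=> f; apply/Lspace_eqP; near=> x => _.
rewrite (near (addE (Lspace_opp f) f) x)//= (near (oppE f) x)//=.
by rewrite (near zeroE x)//= addNr.
Unshelve. all: by end_near. Qed.

HB.instance Definition _ := gen_eqMixin Lp.
HB.instance Definition _ := gen_choiceMixin Lp.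
HB.instance Definition _ := GRing.isZmodule.Build Lp addA addC add0 addN.

Let scaleA a b f :
  Lspace_scale a (Lspace_scale b f) = Lspace_scale (a * b) f.
Proof.
apply/Lspace_eqP; near=> x => _.
rewrite (near (scaleE a (Lspace_scale b f)) x)//= (near (scaleE b f) x)//=.
by rewrite (near (scaleE (a * b) f) x)//= scalerA.
Unshelve. all: by end_near. Qed.

Let scale1 : left_id 1 Lspace_scale.
Proof.
move=> f; apply/Lspace_eqP; near=> x => _.
by rewrite (near (scaleE 1 f) x)//= scale1r.
Unshelve. all: by end_near. Qed.

Let scaleDr : right_distributive Lspace_scale +%R.
Proof.
move=> a f g; apply/Lspace_eqP; near=> x => _.
rewrite (near (scaleE a (f + g)) x)//= (near (addE f g) x)//=.
rewrite (near (addE (Lspace_scale a f) (Lspace_scale a g)) x)//=.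
by rewrite (near (scaleE a f) x)//= (near (scaleE a g) x)//= scalerDr.
Unshelve. all: by end_near. Qed.

Let scaleDl f : {morph Lspace_scale^~ f : a b / a + b}.
Proof.
move=> a b; apply/Lspace_eqP; near=> x => _.
rewrite (near (scaleE (a + b) f) x)//=.
rewrite (near (addE (Lspace_scale a f) (Lspace_scale b f)) x)//=.
by rewrite (near (scaleE a f) x)//= (near (scaleE b f) x)//= scalerDl.
Unshelve. all: by end_near. Qed.

HB.instance Definition _ :=
  GRing.Zmodule_isLmodule.Build R Lp scaleA scale1 scaleDr scaleDl.

Definition Lspace_norm f : R := fine 'N[mu]_p[EFin \o (f : X -> R)]%E.

Let Lspace_mfun f : measurable_fun [set: X] (f : X -> R).
Proof. exact: (@measurable_funPT _ _ X (measurableTypeR R)). Qed.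

Let normE f : (Lspace_norm f)%:E = 'N[mu]_p[EFin \o (f : X -> R)]%E.
Proof.
exact: (finite_norm_fine (Lfun_Sub p1 (Lspace_Lfun f))).
Qed.

Let normD f g : Lspace_norm (f + g) <= Lspace_norm f + Lspace_norm g.
Proof.
rewrite -lee_fin EFinD !normE (Lnorm_ae_eq p1 _ _ (addE f g)).
- exact: eminkowski.
- exact: Lspace_mfun.
- exact: measurable_funD.
Qed.

Let normZ a f : Lspace_norm (a *: f) = `|a| * Lspace_norm f.
Proof.
apply: EFin_inj; rewrite EFinM !normE (Lnorm_ae_eq p1 _ _ (scaleE a f)).
- exact: (LnormZ (Lfun_Sub p1 (Lspace_Lfun f))).
- exact: Lspace_mfun.
- exact: measurable_funM.
Qed.

Let norm_eq0 f : Lspace_norm f = 0 -> f = 0.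
Proof.
move=> f0; apply/Lspace_eqP.
have /= H := fine_Lnormr_eq0 (f := Lfun_Sub p1 (Lspace_Lfun f)) f0.
near=> x => _.
rewrite (near zeroE x)//.
exact: (near H x).
Unshelve. all: by end_near. Qed.

HB.instance Definition _ :=
  @Lmodule_isNormed.Build R Lp Lspace_norm normD normZ norm_eq0.

End Lspace_normed.


Notation L2 mu := (LspaceType mu (lee1n 2)).

Section Lclass.
Context d (X : measurableType d) (R : realType).
Variables (mu : {measure set X -> \bar R}) (p : \bar R) (p1 : (1 <= p)%E).

(** The class [f]_~ of [f] in L_p(mu); the value 0 for functions [f] outside
    L_p(mu) is only there to make the map total. *)
Definition Lclass (f : X -> R) : LspaceType mu p1 :=
  if pselect (f \in Lfun mu p) is left Lf then Lclass_of p1 Lf else 0.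

Lemma LclassE (f : X -> R) : f \in Lfun mu p ->
  (Lclass f : X -> R) = f %[ae mu].
Proof. by rewrite /Lclass; case: pselect => // Lf _; exact: Lclass_ofE. Qed.

Lemma LclassK (g : LspaceType mu p1) : Lclass g = g.
Proof. by apply/Lspace_eqP; apply: LclassE; exact: Lspace_Lfun. Qed.

End Lclass.

HB.mixin Record CompleteNormedModule_isHilbert (R : realType) H
    & CompleteNormedModule R H := {
  inner : H -> H -> R ;
  innerC : forall f g, inner f g = inner g f ;
  innerP : forall a f g h, inner (a *: f + g) h = a * inner f h + inner g h ;
  inner_norm : forall f, inner f f = `|f| ^+ 2
}.

#[short(type=hilbertType)]
HB.structure Definition Hilbert (R : realType) :=
  {H of CompleteNormedModule R H & CompleteNormedModule_isHilbert R H}.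

(** A Hilbert space of real-valued functions on [X] is a Hilbert space [H]
    together with an injective linear map [ev] sending an element of [H] to the
    underlying function. *)
Definition is_rkhs (R : realType) (X : Type) (H : hilbertType R)
    (ev : {linear H -> (X -> R)}) (k : X -> X -> R) : Prop :=
  injective ev /\
  forall x, exists kx : H,
    ev kx = (fun y => k y x) /\ forall f : H, ev f x = inner f kx.

Section comparison.
Context (R : realType).
Implicit Types a b : nat -> \bar R.

Definition asymp_le a b : Prop :=
  exists c : R, 0 < c /\ forall n, (1 <= n)%N -> (a n <= c%:E * b n)%E.

Definition asymp_eq a b : Prop := asymp_le a b /\ asymp_le b a.

Definition power_rate (s : R) : nat -> \bar R := fun n => (n%:R `^ s)%:E.

End comparison.

(** The domain of an operator is described by an extended norm [N] on an ambient
    type [E]: it is the space where [N] is finite, and its closed unit ball is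
    the set where [N] is at most 1. *)
Section operators.
Context (R : realType) (E : Type) (F : normedModType R).
Variables (N : E -> \bar R) (T : E -> F).

Definition unit_ball : set E := [set f | (N f <= 1)%E].

(** The infimum is +oo if there is no such [e], i.e. if [T] is unbounded. *)
Definition entropy_number (n : nat) : \bar R :=
  ereal_inf [set e%:E | e in [set e : R | 0 < e /\
    exists x : 'I_(2 ^ n.-1)%N -> F,
      T @` unit_ball `<=` \bigcup_i closed_ball_ normr (x i) e]].

Definition compact_operator : Prop := precompact (T @` unit_ball).

End operators.

(** Spaces [E = {g | N g < +oo}] of elements of L_2(mu), and their inclusion into
    L_p(mu). *)
Section embeddings.
Context d (X : measurableType d) (R : realType).
Variables (mu : {measure set X -> \bar R}) (N : L2 mu -> \bar R).
Variables (p : \bar R) (p1 : (1 <= p)%E).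

(** Meaningful on [E] only if [E] is a subset of L_p(mu), which is part of the
    two notions of embedding below. *)
Definition inclusion (g : L2 mu) : LspaceType mu p1 := Lclass mu p1 g.

Definition subspace_of_Lp : Prop :=
  forall g : L2 mu, (N g < +oo)%E -> (g : X -> R) \in Lfun mu p.

Definition continuously_embedded : Prop :=
  subspace_of_Lp /\
  exists C : R, forall g : L2 mu, (N g < +oo)%E ->
    (`|inclusion g|%:E <= C%:E * N g)%E.

Definition compactly_embedded : Prop :=
  subspace_of_Lp /\ compact_operator N inclusion.

Definition entropy_inclusion : nat -> \bar R := entropy_number N inclusion.

End embeddings.

Section rkhs_spaces.
Context d (X : measurableType d) (R : realType).
Variables (mu : {measure set X -> \bar R}).
Variables (H : hilbertType R) (ev : {linear H -> (X -> R)}).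

(** The map I_(k,mu) : H -> L_p(mu). For a bounded measurable kernel every
    [ev f] is bounded and measurable (it is a pointwise limit of linear
    combinations of sections of the kernel), so that, [mu] being finite, the
    default value of [Lclass] is never used. *)
Definition Ikmu (p : \bar R) (p1 : (1 <= p)%E) (f : H) : LspaceType mu p1 :=
  Lclass mu p1 (ev f).

Definition entropy_Ikmu (p : \bar R) (p1 : (1 <= p)%E) : nat -> \bar R :=
  entropy_number (fun f : H => `|f|%:E) (Ikmu p1).

(** The space [H]_~ and its quotient norm, which is +oo outside [H]_~. *)
Definition quotient_space : set (L2 mu) :=
  [set g | exists f : H, ev f = g %[ae mu]].

Definition quotient_norm (g : L2 mu) : \bar R :=
  ereal_inf [set `|f|%:E | f in [set f : H | ev f = g %[ae mu]]].

Definition K_functional (g : L2 mu) (t : R) : \bar R :=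
  ereal_inf [set (`|g - h|%:E + t%:E * quotient_norm h)%E | h in quotient_space].

(** The norm of [L_2(mu), [H]_~]_(theta, 2), with value +oo outside that space. *)
Definition interp_norm (theta : R) (g : L2 mu) : \bar R :=
  if theta == 1 then quotient_norm g else
  ((\int[lebesgue_measure]_(t in `]0%R, +oo[)
      (((t `^ (- theta))%:E * K_functional g t) ^+ 2 * (t^-1)%:E)) `^ 2^-1)%E.

End rkhs_spaces.

Arguments quotient_space {d X R} mu {H} ev.
Arguments quotient_norm {d X R} mu {H} ev g.
Arguments K_functional {d X R} mu {H} ev g t.
Arguments interp_norm {d X R} mu {H} ev theta g.

(* Main.v *)
Require Import Defs.
From mathcomp Require Import all_boot all_order all_algebra.
From mathcomp Require Import all_classical all_reals all_analysis.
From mathcomp Require Import measurable_realfun ess_sup_inf lra ring.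

Import Order.TTheory GRing.Theory Num.Theory.
Import numFieldNormedType.Exports.
Local Open Scope classical_set_scope.
Local Open Scope ring_scope.

Set Implicit Arguments.
Unset Strict Implicit.
Unset Printing Implicit Defensive.

(** Write H_theta for the interpolation space (H_1 being [H]_~), B_theta for its
    unit ball and K for the K-functional. The argument uses only the two
    elementary sides of real interpolation, and no spectral theory.
    - On the target side, |u|_theta <= C |u|_2^(1-theta) |u|_1^theta. Hence a
      cover of B_1 in L_2 with radius A splits B_1 into pieces that are, up to
      translation, in a multiple of A^(1-theta) B_theta, and
        e_(2n-1)(H_1 -> F) <= C e_n(H_1 -> L_2)^(1-theta) e_n(H_theta -> F).
      With theta = beta and F = L_oo this gives the upper bound for H_1 -> L_oo;
      with theta = gamma and F = L_2, it turns the lower bound for H -> L_2 into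
      one for H_gamma -> L_2.
    - On the domain side, a nearly optimal decomposition for K(g, t), with
      t = n^(-1/alpha), gives
        B_gamma <= C t^(gamma-beta) B_beta + C t^(gamma-1) B_1,
      and the covers of B_beta and B_1 in L_oo add up to one of B_gamma.
    Everything else follows from L_oo -> L_2 being bounded. *)

(** * Linear structure of L_p classes and of the inclusions into L_p *)

Section Lspace_operations.
Context d (X : measurableType d) (R : realType).
Variables (mu : {measure set X -> \bar R}) (p : \bar R) (p1 : (1 <= p)%E).
Implicit Types g h : LspaceType mu p1.

Lemma Lspace_addE g h :
  (g + h : LspaceType mu p1) = (g : X -> R) \+ (h : X -> R) %[ae mu].
Proof. exact: Lclass_ofE. Qed.

Lemma Lspace_scaleE a g :
  (a *: g : LspaceType mu p1) = a \*: (g : X -> R) %[ae mu].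
Proof. exact: Lclass_ofE. Qed.

Lemma Lspace_measurable g : measurable_fun [set: X] (g : X -> R).
Proof. exact: (@measurable_funPT _ _ X (measurableTypeR R)). Qed.

Lemma Lfun_measurable (f : X -> R) : f \in Lfun mu p -> measurable_fun [set: X] f.
Proof. by rewrite inE => /andP[/[!inE]]. Qed.

Lemma Lfun_ae_eq (f g : X -> R) : measurable_fun [set: X] g ->
  f = g %[ae mu] -> f \in Lfun mu p -> g \in Lfun mu p.
Proof.
move=> mg fg fL; rewrite inE; apply/andP; split; rewrite inE//=.
rewrite /finite_norm -(Lnorm_ae_eq p1 (Lfun_measurable fL) mg fg).
by have := sub_Lfun_finLfun fL; rewrite inE.
Qed.

Lemma Lclass_ae_eq (f g : X -> R) : f \in Lfun mu p -> g \in Lfun mu p ->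
  f = g %[ae mu] -> Lclass mu p1 f = Lclass mu p1 g.
Proof.
move=> fL gL fg; apply/Lspace_eqP.
apply: (ae_eq_trans (LclassE p1 fL)); apply: (ae_eq_trans fg).
exact/ae_eq_sym/LclassE.
Qed.

Lemma LclassDZ a (f g : X -> R) : f \in Lfun mu p -> g \in Lfun mu p ->
  Lclass mu p1 ((a \*: f) \+ g) = a *: Lclass mu p1 f + Lclass mu p1 g.
Proof.
move=> fL gL; apply/Lspace_eqP.
have fgL := Lfun_add p1 (Lfun_scaler p1 a fL) gL.
have E := LclassE p1 fgL; have Ef := LclassE p1 fL; have Eg := LclassE p1 gL.
have ED := Lspace_addE (a *: Lclass mu p1 f) (Lclass mu p1 g).
have EZ := Lspace_scaleE a (Lclass mu p1 f).
near=> x => _.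
rewrite (near E x)//= (near ED x)//= (near EZ x)//=.
by rewrite (near Ef x)// (near Eg x).
Unshelve. all: by end_near. Qed.

Lemma LclassZ a (f : X -> R) : f \in Lfun mu p ->
  Lclass mu p1 (a \*: f) = a *: Lclass mu p1 f.
Proof.
move=> fL; apply/Lspace_eqP.
have E := LclassE p1 (Lfun_scaler p1 a fL); have Ef := LclassE p1 fL.
have EZ := Lspace_scaleE a (Lclass mu p1 f).
near=> x => _.
by rewrite (near E x)//= (near EZ x)//= (near Ef x).
Unshelve. all: by end_near. Qed.

Lemma Lspace_norm_fin g : `|g|%:E = 'N[mu]_p[EFin \o (g : X -> R)]%E.
Proof. exact: (finite_norm_fine (Lfun_Sub p1 (Lspace_Lfun g))). Qed.

End Lspace_operations.

Section inclusion_linear.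
Context d (X : measurableType d) (R : realType).
Variables (mu : {measure set X -> \bar R}) (p : \bar R) (p1 : (1 <= p)%E).
Implicit Types g h : L2 mu.

(** The representative of [a *: g + h] agrees with the pointwise combination only almost everywhere,
    so membership is transported along that equality. *)
Lemma inclusion_Lfun a g h : (g : X -> R) \in Lfun mu p ->
  (h : X -> R) \in Lfun mu p -> ((a *: g + h : L2 mu) : X -> R) \in Lfun mu p.
Proof.
move=> gL hL.
apply: (Lfun_ae_eq p1 _ _ (Lfun_add p1 (Lfun_scaler p1 a gL) hL)).
  exact: Lspace_measurable.
have ED := Lspace_addE (a *: g) h; have EZ := Lspace_scaleE a g.
near=> x => _.
by rewrite (near ED x)//= (near EZ x)//=.
Unshelve. all: by end_near. Qed.

Lemma inclusionDZ a g h : (g : X -> R) \in Lfun mu p ->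
  (h : X -> R) \in Lfun mu p ->
  inclusion p1 (a *: g + h) = a *: inclusion p1 g + inclusion p1 h.
Proof.
move=> gL hL; rewrite /inclusion -LclassDZ//; apply: Lclass_ae_eq.
- exact: inclusion_Lfun.
- exact: (Lfun_add p1 (Lfun_scaler p1 a gL) hL).
have ED := Lspace_addE (a *: g) h; have EZ := Lspace_scaleE a g.
near=> x => _.
by rewrite (near ED x)//= (near EZ x)//=.
Unshelve. all: by end_near. Qed.

End inclusion_linear.

(** * The quotient norm of [H]_~ and the K-functional *)

Section quotient.
Context d (X : measurableType d) (R : realType).
Variables (mu : {measure set X -> \bar R}).
Variables (H : hilbertType R) (ev : {linear H -> (X -> R)}).
Implicit Types (g h : L2 mu) (t : R).
Local Notation q := (quotient_norm mu ev).
Local Notation K := (K_functional mu ev).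

Lemma quotient_norm_le g (f : H) : ev f = g %[ae mu] -> (q g <= `|f|%:E)%E.
Proof. by move=> fg; apply: ereal_inf_lbound; exists f. Qed.

Lemma quotient_norm_lt g (r : R) : (q g < r%:E)%E ->
  exists2 f : H, `|f| < r & ev f = g %[ae mu].
Proof. by move=> /ereal_inf_lt[_ [f fg <-]]; rewrite lte_fin => fr; exists f. Qed.

Lemma quotient_norm_ge0 g : (0 <= q g)%E.
Proof. by apply: le_ereal_inf_tmp => _ [f _ <-]; rewrite lee_fin. Qed.

(** Near-optimal preimages of [g] and [h] combine linearly. The infima need not be attained; the
    slack [e'] on each is chosen so that the total loss [(|a| + 1) * e'] is exactly [e]. *)
Lemma quotient_normDZ a g h (r s : R) : (q g <= r%:E)%E -> (q h <= s%:E)%E ->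
  (q (a *: g + h)%R <= (`|a| * r + s)%:E)%E.
Proof.
move=> gr hs; apply/lee_addgt0Pr => e e0.
pose e' := e / (`|a| + 1).
have a1 : 0 < `|a| + 1 by rewrite ltr_wpDl.
have e'0 : 0 < e' by rewrite divr_gt0.
have [|f fr fg] := @quotient_norm_lt g (r + e').
  by rewrite (le_lt_trans gr)// lte_fin ltrDl.
have [|f' fs fh] := @quotient_norm_lt h (s + e').
  by rewrite (le_lt_trans hs)// lte_fin ltrDl.
apply: (@le_trans _ _ `|a *: f + f'|%:E).
  apply: quotient_norm_le; rewrite linearP.
  have ED := Lspace_addE (a *: g) h; have EZ := Lspace_scaleE a g.
  near=> x => _.
  rewrite (near ED x)//= (near EZ x)//=.
  have <- // := near fg x; have <- // := near fh x.
rewrite -EFinD lee_fin (le_trans (ler_normD _ _))// normrZ.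
have -> : e = (`|a| + 1) * e' by rewrite /e' mulrC divfK// gt_eqF.
have := ler_wpM2l (normr_ge0 a) (ltW fr); move: fs; lra.
Unshelve. all: by end_near. Qed.

Lemma quotient_norm0 : q 0 = 0%E.
Proof.
apply/eqP; rewrite eq_le quotient_norm_ge0 andbT.
rewrite (le_trans (@quotient_norm_le 0 0 _))// ?normr0//.
rewrite linear0; apply: ae_eq_sym.
exact: (Lclass_ofE (lee1n 2) (Lfun_submod_closed mu (lee1n 2)).1).
Qed.

Lemma quotient_normZ a g (r : R) : (q g <= r%:E)%E ->
  (q (a *: g)%R <= (`|a| * r)%:E)%E.
Proof.
move=> gr; rewrite -[a *: g]addr0 -[`|a| * r]addr0.
by apply: quotient_normDZ => //; rewrite quotient_norm0.
Qed.

Lemma quotient_spaceP g : quotient_space mu ev g <-> (q g < +oo)%E.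
Proof.
split=> [[f fg]|]; first exact: le_lt_trans (quotient_norm_le fg) (ltry _).
by move=> /ereal_inf_lt[_ [f fg <-]] _; exists f.
Qed.

Lemma K_functional_ge0 g t : 0 <= t -> (0 <= K g t)%E.
Proof.
move=> t0; apply: le_ereal_inf_tmp => _ [h _ <-].
by apply: adde_ge0; rewrite ?lee_fin// mule_ge0// ?lee_fin// quotient_norm_ge0.
Qed.

Lemma K_functional_le g h t (a r : R) : 0 <= t -> `|g - h| <= a ->
  (q h <= r%:E)%E -> (K g t <= (a + t * r)%:E)%E.
Proof.
move=> t0 gha hr; apply: (@le_trans _ _ (`|(g - h)%R|%:E + t%:E * q h)%E).
  apply: ereal_inf_lbound; exists h => //.
  by apply/quotient_spaceP; rewrite (le_lt_trans hr)// ltry.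
have -> : (a + t * r)%:E = (a%:E + t%:E * r%:E)%E by [].
by rewrite leeD// ?lee_fin// lee_wpmul2l// lee_fin.
Qed.

(** Extracts a near-optimal decomposition, with real bounds [a] and [s] in place of the
    extended-valued norms. *)
Lemma K_functional_lt g t (r : R) : 0 < t -> (K g t < r%:E)%E ->
  exists h a s, [/\ `|g - h| <= a, (q h <= s%:E)%E, 0 <= a, 0 <= s & a + t * s < r].
Proof.
move=> t0 /ereal_inf_lt[_ [h /quotient_spaceP hq <-]].
have qf : q h \is a fin_num by rewrite ge0_fin_numE// quotient_norm_ge0.
rewrite -(fineK qf) -EFinM -EFinD lte_fin => ltr.
exists h, `|g - h|, (fine (q h)); split => //; first by rewrite fineK.
by rewrite fine_ge0// quotient_norm_ge0.
Qed.

Lemma K_functional_le_norm g t : 0 <= t -> (K g t <= `|g|%:E)%E.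
Proof.
move=> t0; rewrite -[`|g|]addr0 -[X in _ + X](mulr0 t).
by apply: (@K_functional_le _ 0); rewrite ?subr0// quotient_norm0.
Qed.

Lemma K_functional_le_quotient g t (r : R) : 0 <= t -> (q g <= r%:E)%E ->
  (K g t <= (t * r)%:E)%E.
Proof.
move=> t0 gr; rewrite -[t * r]add0r.
by apply: (@K_functional_le _ g); rewrite ?subrr ?normr0.
Qed.

Lemma K_functional_fin_num g t : 0 <= t -> K g t \is a fin_num.
Proof.
move=> t0; rewrite ge0_fin_numE ?K_functional_ge0//.
exact: le_lt_trans (K_functional_le_norm _ t0) (ltry _).
Qed.

Lemma K_functional_homo g s t : 0 <= s -> s <= t -> (K g s <= K g t)%E.
Proof.
move=> s0 st; apply: le_ereal_inf_tmp => _ [h hq <-].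
apply: (@le_trans _ _ (`|(g - h)%R|%:E + s%:E * q h)%E).
  by apply: ereal_inf_lbound; exists h.
by rewrite leeD2l// lee_wpmul2r ?lee_fin// quotient_norm_ge0.
Qed.

Lemma K_functionalDZ c g h t (a b : R) : 0 < t -> (K g t <= a%:E)%E ->
  (K h t <= b%:E)%E -> (K (c *: g + h)%R t <= (`|c| * a + b)%:E)%E.
Proof.
move=> t0 ga hb; apply/lee_addgt0Pr => e e0.
pose e' := e / (`|c| + 1).
have c1 : 0 < `|c| + 1 by rewrite ltr_wpDl.
have e'0 : 0 < e' by rewrite divr_gt0.
have [|g' [a1 [s1 [ga1 gs1 a10 s10 l1]]]] := @K_functional_lt g t (a + e') t0.
  by rewrite (le_lt_trans ga)// lte_fin ltrDl.
have [|h' [a2 [s2 [ga2 gs2 a20 s20 l2]]]] := @K_functional_lt h t (b + e') t0.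
  by rewrite (le_lt_trans hb)// lte_fin ltrDl.
apply: (le_trans (@K_functional_le (c *: g + h) (c *: g' + h') t (`|c| * a1 + a2)
  (`|c| * s1 + s2) (ltW t0) _ (quotient_normDZ c gs1 gs2))).
  rewrite opprD addrACA -scalerBr (le_trans (ler_normD _ _))// normrZ.
  by rewrite lerD// ler_wpM2l.
rewrite -EFinD lee_fin.
have -> : e = (`|c| + 1) * e' by rewrite /e' mulrC divfK// gt_eqF.
have := ler_wpM2l (normr_ge0 c) (ltW l1); move: l2; lra.
Qed.

Lemma K_functionalB g h t (a b : R) : 0 < t -> (K g t <= a%:E)%E ->
  (K h t <= b%:E)%E -> (K (g - h)%R t <= (a + b)%:E)%E.
Proof.
move=> t0 ga hb.
by have := K_functionalDZ (-1) t0 hb ga;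
  rewrite scaleN1r [- h + g]addrC normrN1 mul1r [b + a]addrC.
Qed.

Lemma K_functionalZ c g t : 0 < t -> fine (K (c *: g) t) <= `|c| * fine (K g t).
Proof.
move=> t0; rewrite -lee_fin fineK ?K_functional_fin_num ?(ltW t0)//.
rewrite -[c *: g]addr0 -[`|c| * _]addr0. apply: K_functionalDZ => //.
  by rewrite fineK// K_functional_fin_num// ltW.
by rewrite (le_trans (K_functional_le_norm _ (ltW t0)))// normr0.
Qed.

End quotient.

(** * Integrals over the half-line of functions dominated by powers *)

Section power_integrals.
Context (R : realType).
Local Notation leb := (@lebesgue_measure R).

Lemma integral_powR (c r a b : R) : r != 0 -> 0 < a -> a < b ->
  (\int[leb]_(x in `[a, b]) (c * x `^ (r - 1))%:E =
   (c / r * (b `^ r - a `^ r))%:E)%E.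
Proof.
move=> r0 a0 ab.
have cont (s x : R) : 0 < x -> {for x, continuous (@powR R ^~ s)}.
  move=> x0; apply: differentiable_continuous; apply/derivable1_diffP.
  by apply: derivable_powR; rewrite in_itv/= x0.
have contc (s k x : R) : 0 < x -> {for x, continuous (fun y => k * y `^ s)}.
  by move=> x0; apply: continuousM; [exact: cvg_cst|exact: cont].
rewrite (@continuous_FTC2 _ _ (fun x => c / r * x `^ r) _ _ ab).
- by rewrite mulrBr.
- apply: continuous_in_subspaceT => x; rewrite inE/= in_itv/= => /andP[ax _].
  exact/contc/lt_le_trans/ax.
- split.
  + move=> x; rewrite in_itv/= => /andP[ax _]; apply: derivableM => //.
    by apply: derivable_powR; rewrite in_itv/= andbT (lt_trans a0).
  + exact/cvg_at_right_filter/contc.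
  + exact/cvg_at_left_filter/contc/(lt_trans a0).
- move=> x; rewrite in_itv/= => /andP[ax _].
  have x0 : 0 < x by rewrite (lt_trans a0).
  rewrite derive1E deriveM//; last by apply: derivable_powR; rewrite in_itv/= x0.
  have [_ ->] := is_derive1_powR r x0.
  by rewrite derive_cst scaler0 addr0 /GRing.scale/= mulrA divfK.
Qed.

(** Monotone convergence along the intervals from [t / (n + 2)] to [t * (n + 2)]: they exhaust the
    half-line, and the shift by 2 keeps [t] strictly inside each of them. *)
Lemma integral_half_line_le (f : R -> R) (t M : R) : 0 < t ->
  measurable_fun `](0 : R), +oo[ f -> (forall x, 0 < x -> 0 <= f x) ->
  (forall a b, 0 < a -> a < t -> t < b ->
    (\int[leb]_(x in `[a, b]) (f x)%:E <= M%:E)%E) ->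
  (\int[leb]_(x in `]0%R, +oo[) (f x)%:E <= M%:E)%E.
Proof.
move=> t0 mf f0 fM.
pose F (n : nat) : set R := [set` `[t / n.+2%:R, t * n.+2%:R]].
have F0 n x : F n x -> 0 < x.
  by rewrite /F/= in_itv/= => /andP[+ _]; apply: lt_le_trans; rewrite divr_gt0.
have FE : (`]0%R, +oo[%classic : set R) = \bigcup_n F n.
  apply/seteqP; split=> [x|x [n _ /F0]]; rewrite /= in_itv/= andbT//.
  move=> x0; pose n := maxn (Num.truncn (t / x)) (Num.truncn (x / t)).
  have n1 : t / x <= n.+2%:R.
    rewrite (le_trans (ltW (truncnS_gt _)))// ler_nat.
    by rewrite ltnS leqW// leq_maxl.
  have n2 : x / t <= n.+2%:R.
    rewrite (le_trans (ltW (truncnS_gt _)))// ler_nat.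
    by rewrite ltnS leqW// leq_maxr.
  exists n => //; rewrite /F/= in_itv/=; apply/andP; split.
    by rewrite ler_pdivrMr// mulrC -ler_pdivrMr.
  by rewrite mulrC -ler_pdivrMr.
have mfF n : measurable_fun (F n) (fun x : R => (f x)%:E).
  apply/measurable_EFinP; apply: measurable_funS mf => //.
  by rewrite FE; exact: bigcup_sup.
have ndF : nondecreasing_seq F.
  apply/nondecreasing_seqP => n; rewrite subsetEset /F.
  apply: subset_itv; rewrite bnd_simp.
    by rewrite ler_pM2l// lef_pV2 ?posrE// ler_nat.
  by rewrite ler_pM2l// ler_nat.
have fF0 n x : F n x -> (0 <= (f x)%:E)%E by move=> /F0 /f0; rewrite lee_fin.
have mF n : measurable (F n) by exact: measurable_itv.
have cv : (\int[leb]_(x in F n) (f x)%:E @[n --> \oo] -->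
    \int[leb]_(x in \bigcup_n F n) (f x)%:E)%E.
  exact: ge0_nondecreasing_set_cvg_integral.
rewrite FE -(cvg_lim _ cv)//; apply: lime_le.
  by apply/cvg_ex; exists (\int[leb]_(x in \bigcup_n F n) (f x)%:E)%E.
apply: nearW => n; apply: fM.
- by rewrite divr_gt0.
- by rewrite ltr_pdivrMr// ltr_pMr// ltr1n.
- by rewrite ltr_pMr// ltr1n.
Qed.

(** The integral is split at [t]: the first power is integrable at 0 because [r > 0], the second at
    infinity because [s > 0]. The boundary terms at [a] and [b] have a favourable sign and are
    dropped. *)
Lemma integral_two_powers_le (f : R -> R) (c1 c2 r s t : R) :
  0 < r -> 0 < s -> 0 < t -> 0 <= c1 -> 0 <= c2 ->
  measurable_fun `](0 : R), +oo[ f -> (forall x, 0 < x -> 0 <= f x) ->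
  (forall x, 0 < x -> x <= t -> f x <= c1 * x `^ (r - 1)) ->
  (forall x, t <= x -> f x <= c2 * x `^ (- s - 1)) ->
  (\int[leb]_(x in `]0%R, +oo[) (f x)%:E <=
   (c1 / r * t `^ r + c2 / s * t `^ (- s))%:E)%E.
Proof.
move=> r0 s0 t0 c10 c20 mf f0 f1 f2.
apply: (integral_half_line_le t0 mf f0) => a b a0 at_ tb.
have mfs (A : set R) : A `<=` (`]0%R, +oo[%classic : set R) ->
    measurable_fun A (fun x : R => (f x)%:E).
  by move=> A0; apply/measurable_EFinP; apply: measurable_funS mf.
have sab : `[a, b] `<=` (`]0%R, +oo[%classic : set R).
  by move=> x; rewrite /= !in_itv/= andbT => /andP[+ _]; exact: lt_le_trans.
have sat : `[a, t] `<=` (`]0%R, +oo[%classic : set R).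
  by move=> x; rewrite /= !in_itv/= andbT => /andP[+ _]; exact: lt_le_trans.
have stb : `[t, b] `<=` (`]0%R, +oo[%classic : set R).
  by move=> x; rewrite /= !in_itv/= andbT => /andP[+ _]; exact: lt_le_trans.
have mpow c u : measurable_fun `](0 : R), +oo[ (fun x : R => c * x `^ u).
  by apply: measurable_funM => //; exact: measurable_funS (measurable_powR _).
have mpows c u (A : set R) : A `<=` (`]0%R, +oo[%classic : set R) ->
    measurable_fun A (fun x : R => (c * x `^ u)%:E).
  by move=> A0; apply/measurable_EFinP; apply: measurable_funS (mpow c u).
have pos (A : set R) x : A `<=` (`]0%R, +oo[%classic : set R) -> A x -> 0 < x.
  by move=> A0 /A0; rewrite /= in_itv/= andbT.
have -> : (`[a, b]%classic : set R) = `[a, t] `|` `]t, b].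
  by rewrite -itv_bndbnd_setU// bnd_simp ltW.
have stb' : `]t, b] `<=` `[t, b] by apply: subset_itv; rewrite bnd_simp.
rewrite ge0_integral_setU//=; first last.
- apply/disj_setPS => x [] /=; rewrite !in_itv/= => /andP[_ xt] /andP[tx _].
  by have := lt_le_trans tx xt; rewrite ltxx.
- move=> x [/(pos _ _ sat) /f0|/stb' /(pos _ _ stb) /f0]; by rewrite lee_fin.
- apply: mfs => x [/sat//|/stb'/stb//].
rewrite EFinD; apply: leeD.
  apply: (@le_trans _ _ (\int[leb]_(x in `[a, t]) (c1 * x `^ (r - 1))%:E)%E).
    apply: ge0_le_integral => //.
    - by move=> x /(pos _ _ sat) /f0; rewrite lee_fin.
    - exact: mfs.
    - exact: mpows.
    - move=> x xat; have x0 := pos _ _ sat xat; move: xat.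
      by rewrite /= in_itv/= => /andP[_ xt]; rewrite lee_fin f1.
  rewrite integral_powR ?gt_eqF// lee_fin ler_wpM2l ?divr_ge0 ?(ltW r0) ?(ltW s0)//.
  by rewrite gerBl powR_ge0.
(* The endpoint [t] is added back because [integral_powR] is stated for closed intervals. *)
apply: (@le_trans _ _ (\int[leb]_(x in `[t, b]) (f x)%:E)%E).
  apply: ge0_subset_integral => //.
  - exact: mfs.
  - by move=> x /(pos _ _ stb) /f0; rewrite lee_fin.
apply: (@le_trans _ _ (\int[leb]_(x in `[t, b]) (c2 * x `^ (- s - 1))%:E)%E).
  apply: ge0_le_integral => //.
  - by move=> x /(pos _ _ stb) /f0; rewrite lee_fin.
  - exact: mfs.
  - exact: mpows.
  - by move=> x; rewrite /= in_itv/= => /andP[tx _]; rewrite lee_fin f2.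
rewrite integral_powR ?lt_eqF// ?oppr_lt0// lee_fin.
rewrite invrN mulrN mulNr -mulrN opprB ler_wpM2l ?divr_ge0 ?(ltW r0) ?(ltW s0)//.
by rewrite gerBl powR_ge0.
Qed.

End power_integrals.

Lemma powRD_gt0 (R : realType) (x r s : R) : 0 < x ->
  x `^ (r + s) = x `^ r * x `^ s.
Proof. by move=> x0; rewrite powRD// (gt_eqF x0) implybT. Qed.

(** * Interpolation norms: bounds from and for the K-functional *)

Section interpolation.
Context d (X : measurableType d) (R : realType).
Variables (mu : {measure set X -> \bar R}).
Variables (H : hilbertType R) (ev : {linear H -> (X -> R)}).
Implicit Types (g h u : L2 mu) (t theta : R).
Local Notation q := (quotient_norm mu ev).
Local Notation K := (K_functional mu ev).
Local Notation N := (interp_norm mu ev).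
Local Notation leb := (@lebesgue_measure R).

Definition interp_integrand theta g t : R :=
  (t `^ (- theta) * fine (K g t)) ^+ 2 / t.

Lemma interp_integrand_ge0 theta g t : 0 < t -> 0 <= interp_integrand theta g t.
Proof. by move=> t0; rewrite /interp_integrand divr_ge0 ?sqr_ge0 ?(ltW t0). Qed.

Lemma fine_K_functional_ge0 g t : 0 <= t -> 0 <= fine (K g t).
Proof. by move=> t0; rewrite fine_ge0// K_functional_ge0. Qed.

Lemma measurable_interp_integrand theta g :
  measurable_fun `](0%R : R), +oo[ (interp_integrand theta g).
Proof.
have mpow (u : R) : measurable_fun `](0%R : R), +oo[ (@powR R ^~ u).
  exact: measurable_funS (measurable_powR _).
(* Measurability comes from monotonicity of the K-functional, which holds for nonnegative
   parameters; truncating at 0 makes the function monotone on the whole line without changing it for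
   [t > 0]. *)
apply: (@eq_measurable_fun _ _ _ _ _ (fun t =>
    (t `^ (- theta) * fine (K g (Num.max t 0))) ^+ 2 * t `^ (-1))) => [t|].
  rewrite inE/= in_itv/= andbT => t0.
  by rewrite (max_idPl (ltW t0)) powR_inv1 ?(ltW t0).
apply: measurable_funM => //; apply: measurable_funX; apply: measurable_funM => //.
apply: nondecreasing_measurable => //= s t st.
have m0 (x : R) : 0 <= Num.max x 0 by rewrite le_max lexx orbT.
rewrite fine_le ?K_functional_fin_num// K_functional_homo//.
by rewrite ge_max le_max st m0.
Qed.

Lemma measurable_EFin_interp_integrand theta g :
  measurable_fun `](0%R : R), +oo[ (fun t => (interp_integrand theta g t)%:E).
Proof. by apply/measurable_EFinP; exact: measurable_interp_integrand. Qed.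

Lemma interp_normE theta g : theta != 1 ->
  N theta g = ((\int[leb]_(t in `](0%R : R), +oo[)
    (interp_integrand theta g t)%:E) `^ 2^-1)%E.
Proof.
move=> /negPf t1; rewrite /interp_norm t1; congr (_ `^ _)%E.
apply: eq_integral => t; rewrite inE/= in_itv/= andbT => t0.
rewrite -[in LHS](fineK (K_functional_fin_num ev g (ltW t0))).
by [].
Qed.

Lemma interp_norm_ge0 theta g : (0 <= N theta g)%E.
Proof.
rewrite /interp_norm; case: ifP => _; first exact: quotient_norm_ge0.
exact: poweR_ge0.
Qed.

Lemma interp_norm_le theta g (r : R) : theta != 1 -> 0 <= r ->
  (\int[leb]_(t in `](0%R : R), +oo[) (interp_integrand theta g t)%:E <=
    (r ^+ 2)%:E)%E -> (N theta g <= r%:E)%E.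
Proof.
move=> t1 r0 Ir; rewrite interp_normE//.
have -> : r%:E = ((r ^+ 2)%:E `^ 2^-1)%E.
  by rewrite poweR_EFin powR12_sqrt ?sqr_ge0// sqrtr_sqr ger0_norm.
apply: gt0_ler_poweR => //; rewrite ?in_itv/= ?leey ?andbT ?lee_fin ?sqr_ge0//.
apply: integral_ge0 => t; rewrite /= in_itv/= andbT => t0.
by rewrite lee_fin interp_integrand_ge0.
Qed.

Lemma integral_interp_norm_le theta g (r : R) : theta != 1 ->
  (N theta g <= r%:E)%E ->
  (\int[leb]_(t in `](0%R : R), +oo[) (interp_integrand theta g t)%:E <=
    (r ^+ 2)%:E)%E.
Proof.
move=> t1 Nr; have r0 : 0 <= r by rewrite -lee_fin (le_trans _ Nr)// interp_norm_ge0.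
move: Nr; rewrite interp_normE//; set I := (\int[_]_(_ in _) _)%E => Ir.
have I0 : (0 <= I)%E.
  apply: integral_ge0 => t; rewrite /= in_itv/= andbT => t0.
  by rewrite lee_fin interp_integrand_ge0.
have -> : I = ((I `^ 2^-1) `^ 2)%E by rewrite -poweRrM mulVf// poweRe1.
have -> : (r ^+ 2)%:E = (r%:E `^ 2)%E by rewrite poweR_EFin powR_mulrn.
by apply: gt0_ler_poweR; rewrite ?in_itv/= ?leey ?andbT ?lee_fin ?poweR_ge0.
Qed.

Lemma interp_normZ theta c g (r : R) : (N theta g <= r%:E)%E ->
  (N theta (c *: g)%R <= (`|c| * r)%:E)%E.
Proof.
have [->|t1] := eqVneq theta 1.
  by rewrite /interp_norm eqxx; exact: quotient_normZ.
move=> Nr; have r0 : 0 <= r by rewrite -lee_fin (le_trans _ Nr)// interp_norm_ge0.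
apply: interp_norm_le => //; first by rewrite mulr_ge0.
have Ir := integral_interp_norm_le t1 Nr.
apply: (@le_trans _ _ (\int[leb]_(t in `](0%R : R), +oo[)
    ((`|c| ^+ 2)%:E * (interp_integrand theta g t)%:E))%E).
  apply: ge0_le_integral => //.
  - by move=> t; rewrite /= in_itv/= andbT => t0; rewrite lee_fin interp_integrand_ge0.
  - exact: measurable_EFin_interp_integrand.
  - by apply: measurable_funeM; exact: measurable_EFin_interp_integrand.
  - move=> t; rewrite /= in_itv/= andbT => t0; rewrite -EFinM lee_fin.
    rewrite /interp_integrand mulrA ler_pM2r ?invr_gt0// -exprMn.
    rewrite ler_pXn2r ?nnegrE ?mulr_ge0 ?powR_ge0 ?fine_K_functional_ge0 ?(ltW t0)//.
    by rewrite mulrCA ler_wpM2l ?powR_ge0// K_functionalZ.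
rewrite ge0_integralZl_EFin ?sqr_ge0//.
- by rewrite exprMn [leRHS]EFinM lee_wpmul2l// lee_fin sqr_ge0.
- by move=> t; rewrite /= in_itv/= andbT => t0; rewrite lee_fin interp_integrand_ge0.
- exact: measurable_EFin_interp_integrand.
Qed.

(** The K-functional is nondecreasing, so on the interval from [t] to [2 * t] the integrand is at
    least the constant [m] below. The whole integral being at most 1, [m * t <= 1], which bounds
    K(g, t). *)
Lemma K_functional_le_interp theta g t : 0 < theta < 1 ->
  (N theta g <= 1)%E -> 0 < t -> (K g t <= (4 * t `^ theta)%:E)%E.
Proof.
move=> /andP[th0 th1] N1 t0.
have I1 := integral_interp_norm_le (negbT (lt_eqF th1)) N1.
have t2 : 0 < 2 * t by rewrite mulr_gt0.
pose k := fine (K g t).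
have k0 : 0 <= k by rewrite fine_K_functional_ge0 ?ltW.
pose m := ((2 * t) `^ (- theta) * k) ^+ 2 / (2 * t).
pose D : set R := [set` `[t, 2 * t]].
have DE x : D x = (t <= x <= 2 * t) by rewrite /D/= in_itv.
have mD : measurable D by exact: measurable_itv.
have pos x : D x -> 0 < x.
  by rewrite DE => /andP[+ _]; exact: lt_le_trans.
have sub : D `<=` (`](0%R : R), +oo[%classic : set R).
  by move=> x /pos; rewrite /= in_itv/= andbT.
have : ((m * t)%:E <= (1 ^+ 2)%:E)%E.
  apply: le_trans I1.
  apply: (@le_trans _ _ (\int[leb]_(x in D) (interp_integrand theta g x)%:E)%E);
    last first.
    apply: ge0_subset_integral => //.
      exact: measurable_EFin_interp_integrand.
    by move=> x; rewrite /= in_itv/= andbT => x0; rewrite lee_fin interp_integrand_ge0.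
  apply: (@le_trans _ _ (\int[leb]_(x in D) (cst m%:E) x)%E).
    rewrite integral_cst//= /D lebesgue_measure_itv/= lte_fin.
    have -> : t < 2 * t by rewrite ltr_pMl// ltr1n.
    by rewrite -EFinB -EFinM lee_fin [2 * t]mulr_natl mulr2n addrK.
  apply: ge0_le_integral => //.
  - by move=> x _; rewrite lee_fin divr_ge0 ?sqr_ge0// ltW.
  - apply: measurable_funS (measurable_EFin_interp_integrand _ _) => //.
  - move=> x xt; have x0 := pos _ xt; move: xt; rewrite DE => /andP[tx x2].
    rewrite lee_fin; apply: ler_pM; rewrite ?sqr_ge0 ?invr_ge0 ?(ltW t2)//; last first.
      by rewrite lef_pV2 ?posrE.
    rewrite ler_pXn2r ?nnegrE ?mulr_ge0 ?powR_ge0 ?fine_K_functional_ge0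
      ?(ltW x0) ?(ltW t0)//.
    apply: ler_pM; rewrite ?powR_ge0//.
      rewrite !powRN lef_pV2 ?posrE ?powR_gt0//.
      by rewrite ge0_ler_powR ?nnegrE ?(ltW th0) ?(ltW x0) ?(ltW t2).
    by rewrite fine_le ?K_functional_fin_num ?(ltW t0) ?(ltW x0)//
      (K_functional_homo _ _ (ltW t0) tx).
rewrite lee_fin expr1n /m.
have -> : ((2 * t) `^ (- theta) * k) ^+ 2 / (2 * t) * t =
          ((2 * t) `^ (- theta) * k) ^+ 2 / 2 by field; rewrite gt_eqF.
rewrite ler_pdivrMr// mul1r => le2.
(* The square root of 2 is rounded up to 2; the other factor 2 of the constant 4 bounds
   [2 ^ theta]. *)
have {le2} : (2 * t) `^ (- theta) * k <= 2.
  rewrite -(@ler_pXn2r _ 2) ?nnegrE ?mulr_ge0 ?powR_ge0//.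
  by rewrite (le_trans le2)// -natrX ler_nat.
rewrite powRN mulrC ler_pdivrMr ?powR_gt0// => le2.
rewrite -(fineK (K_functional_fin_num ev g (ltW t0))) lee_fin (le_trans le2)//.
rewrite powRM ?(ltW t0)// mulrA ler_wpM2r ?powR_ge0//.
have -> : 4 = 2 * 2 :> R by rewrite -natrM.
by rewrite ler_wpM2l// ler1_powR ?ler1n// ltW.
Qed.

(** The two inverses come from integrating the powers of exponents [2 * (p - theta) - 1] near 0 and
    [- 2 * theta - 1] near infinity. The summand 1 makes the constant at least 1, hence at most its
    own square. *)
Definition interp_const theta (p : R) : R :=
  1 + (2 * (p - theta))^-1 + (2 * theta)^-1.

Lemma interp_const_ge1 theta (p : R) : 0 < theta -> theta <= p ->
  1 <= interp_const theta p.
Proof.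
move=> t0 tp; rewrite /interp_const -addrA lerDl addr_ge0// invr_ge0 mulr_ge0//.
  by rewrite subr_ge0.
exact: ltW.
Qed.

(** Growth of order [p > theta] makes the weighted square integrable at 0, and boundedness makes it
    integrable at infinity since [theta > 0]. It serves with [p = 1] for the interpolation
    inequality and with [p = gamma] for the decomposition. *)
Lemma interp_norm_le_K theta u (p a t : R) : 0 < theta < 1 -> theta < p ->
  0 < t -> 0 <= a ->
  (forall s, 0 < s -> s <= t -> (K u s <= (a * s `^ p)%:E)%E) ->
  (forall s, t <= s -> (K u s <= (a * t `^ p)%:E)%E) ->
  (N theta u <= (interp_const theta p * (a * t `^ (p - theta)))%:E)%E.
Proof.
move=> /andP[th0 th1] thp t0 a0 K1 K2.
have C1 := interp_const_ge1 th0 (ltW thp).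
apply: interp_norm_le; first by rewrite lt_eqF.
  by rewrite mulr_ge0 ?mulr_ge0 ?powR_ge0// (le_trans _ C1).
have r0 : 0 < 2 * (p - theta) by rewrite mulr_gt0// subr_gt0.
have s0 : 0 < 2 * theta by rewrite mulr_gt0.
have bound x k : 0 < x -> (K u x <= k%:E)%E ->
    interp_integrand theta u x <= (x `^ (- theta) * k) ^+ 2 / x.
  move=> x0 xk; rewrite ler_pM2r ?invr_gt0//.
  have fk : fine (K u x) <= k by rewrite -lee_fin fineK// K_functional_fin_num// ltW.
  have f0 := fine_K_functional_ge0 u (ltW x0).
  rewrite ler_pXn2r ?nnegrE ?mulr_ge0 ?powR_ge0//; last exact: le_trans fk.
  by rewrite ler_wpM2l// powR_ge0.
apply: (le_trans (@integral_two_powers_le _ _ (a ^+ 2) ((a * t `^ p) ^+ 2) _ _ _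
  r0 s0 t0 _ _ _ _ _ _)).
- exact: sqr_ge0.
- exact: sqr_ge0.
- exact: measurable_interp_integrand.
- by move=> x; exact: interp_integrand_ge0.
- move=> x x0 xt; apply: (le_trans (bound _ _ x0 (K1 _ x0 xt))).
  have -> : 2 * (p - theta) - 1 = p + p + (- theta - theta) + -1 by ring.
  rewrite !powRD_gt0// powR_inv1 ?(ltW x0)// le_eqVlt.
  by apply/orP; left; apply/eqP; ring.
- move=> x tx; have x0 : 0 < x by exact: lt_le_trans tx.
  apply: (le_trans (bound _ _ x0 (K2 _ tx))).
  have -> : - (2 * theta) - 1 = - theta - theta + -1 by ring.
  rewrite !powRD_gt0// powR_inv1 ?(ltW x0)// le_eqVlt.
  by apply/orP; left; apply/eqP; ring.
rewrite lee_fin.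
have -> : 2 * (p - theta) = (p - theta) + (p - theta) by ring.
have -> : - (2 * theta) = - theta - theta by ring.
set c1 := p - theta; rewrite [t `^ (c1 + c1)]powRD_gt0// [t `^ (- _ - _)]powRD_gt0//.
have Ec : t `^ p * t `^ (- theta) = t `^ c1 by rewrite -powRD_gt0.
rewrite [leRHS]exprMn.
have -> : (a * t `^ p) ^+ 2 / (2 * theta) * (t `^ (- theta) * t `^ (- theta)) =
  (a * (t `^ p * t `^ (- theta))) ^+ 2 / (2 * theta) by ring.
rewrite Ec.
have -> : a ^+ 2 / (c1 + c1) * (t `^ c1 * t `^ c1) + (a * t `^ c1) ^+ 2 / (2 * theta) =
   ((2 * c1)^-1 + (2 * theta)^-1) * (a * t `^ c1) ^+ 2.
  have -> : c1 + c1 = 2 * c1 by ring.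
  ring.
rewrite ler_wpM2r ?sqr_ge0//.
(* The integral bounds the square of the norm; [C <= C ^ 2] for [C >= 1] avoids taking the root of
   the constant. *)
apply: (@le_trans _ _ (interp_const theta p)).
  by rewrite /interp_const -addrA lerDr.
by rewrite expr2 ler_peMl// (le_trans _ C1).
Qed.

(** K(u, s) is at most both [s * B] and [A]. For [theta = 1] the norm is the quotient norm by
    convention, and the constant is at least 1. *)
Lemma interp_norm_interpolation theta u (A B : R) : 0 < theta <= 1 ->
  0 < A -> 0 < B -> `|u| <= A -> (q u <= B%:E)%E ->
  (N theta u <= (interp_const theta 1 * (A `^ (1 - theta) * B `^ theta))%:E)%E.
Proof.
move=> /andP[th0]; rewrite le_eqVlt => /predU1P[->|th1] A0 B0 uA uB.
  rewrite /interp_norm eqxx subrr powRr0 mul1r powRr1 ?(ltW B0)//.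
  rewrite (le_trans uB)// lee_fin ler_peMl ?(ltW B0)//.
  by rewrite interp_const_ge1.
(* The two bounds on the K-functional meet at [s = A / B]. *)
have t0 : 0 < A / B by rewrite divr_gt0.
have -> : A `^ (1 - theta) * B `^ theta = B * (A / B) `^ (1 - theta).
  rewrite powRM ?invr_ge0 ?(ltW A0) ?(ltW B0)// -[B^-1]powR_inv1 ?(ltW B0)//.
  rewrite -powRrM mulN1r opprB mulrCA; congr (_ * _).
  by rewrite powRD_gt0// powR_inv1 ?(ltW B0)// mulrCA divff ?mulr1// gt_eqF.
apply: interp_norm_le_K => //; rewrite ?th0 ?th1 ?(ltW B0)//.
  move=> s s0 _; rewrite powRr1 ?(ltW s0)// mulrC.
  by apply: K_functional_le_quotient => //; exact: ltW.
move=> s ts; rewrite powRr1 ?(ltW t0)// mulrC divfK ?gt_eqF//.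
rewrite (le_trans (K_functional_le_norm _ _ _)) ?lee_fin//.
by rewrite (le_trans _ ts)// ltW.
Qed.

(** [h] is the [H]_~ part of a near-optimal decomposition at [t]. For [x <= t], K(g - h, x) is at
    most K(g, x) plus [x] times the quotient norm of [h], of order [x ^ gamma] because [gamma < 1];
    for [x >= t] the L_2 norm of [g - h], of order [t ^ gamma], bounds it. *)
Lemma interp_decomposition beta gamma g t : 0 < beta -> beta < gamma ->
  gamma < 1 -> (N gamma g <= 1)%E -> 0 < t ->
  exists h, (q h <= (5 * t `^ (gamma - 1))%:E)%E /\
    (N beta (g - h)%R <= (interp_const beta gamma * (9 * t `^ (gamma - beta)))%:E)%E.
Proof.
move=> b0 bg g1 N1 t0; have g0 : 0 < gamma by exact: lt_trans bg.
have Kg s : 0 < s -> (K g s <= (4 * s `^ gamma)%:E)%E.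
  by apply: K_functional_le_interp => //; rewrite g0.
have tg0 : 0 < t `^ gamma by rewrite powR_gt0.
(* The infimum need not be attained: 5 in place of the 4 of [K_functional_le_interp] leaves room for
   an actual decomposition. *)
have [|h [a [s [ga hs a0 s0 as5]]]] :=
  @K_functional_lt _ _ _ mu H ev g t (5 * t `^ gamma) t0.
  by rewrite (le_lt_trans (Kg _ t0))// lte_fin ltr_pM2r// ltr_nat.
have t1E : t `^ (gamma - 1) = t `^ gamma / t by rewrite powRD_gt0// powR_inv1 ?ltW.
have s5 : s <= 5 * t `^ (gamma - 1).
  rewrite t1E mulrA ler_pdivlMr// mulrC.
  by rewrite (le_trans _ (ltW as5))// lerDr.
have hq : (q h <= (5 * t `^ (gamma - 1))%:E)%E by rewrite (le_trans hs)// lee_fin.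
exists h; split => //; apply: interp_norm_le_K => //.
- by rewrite b0 (lt_trans bg).
- move=> x x0 xt.
  have -> : 9 * x `^ gamma = 4 * x `^ gamma + 5 * x `^ gamma by ring.
  apply: K_functionalB => //; first exact: Kg.
  apply: (le_trans (K_functional_le_quotient (ltW x0) hq)); rewrite lee_fin.
  rewrite mulrCA ler_wpM2l//.
  have -> : x `^ gamma = x * x `^ (gamma - 1).
    by rewrite powRD_gt0// powR_inv1 ?(ltW x0)// mulrCA divff ?mulr1// gt_eqF.
  rewrite ler_wpM2l ?(ltW x0)// -opprB !powRN lef_pV2 ?posrE ?powR_gt0//.
  by rewrite ge0_ler_powR ?nnegrE ?subr_ge0 ?(ltW g1) ?(ltW x0) ?(ltW t0).
- move=> x tx; have x0 : 0 < x by exact: lt_le_trans tx.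
  rewrite (le_trans (K_functional_le_norm _ _ (ltW x0)))// lee_fin.
  rewrite (le_trans ga)//; have : 0 <= t * s by rewrite mulr_ge0// ltW.
  by move: as5 tg0; lra.
Qed.

End interpolation.

(** * Finite covers by balls of a given radius *)

Section covers.
Context (R : realType) (F : normedModType R).
Implicit Types (S : set F) (n m : nat) (e : R).

(** A list of at most [n] centres, instead of a family of exactly [n], makes the notion monotone in
    [n] and lets covers be combined by list operations. *)
Definition covered S n e : Prop := exists s : seq F,
  (size s <= n)%N /\ forall y, S y -> exists2 x, x \in s & `|x - y| <= e.

Lemma sub_covered S S' n e : S `<=` S' -> covered S' n e -> covered S n e.
Proof. by move=> SS' [s [sn cs]]; exists s; split => // y /SS' /cs. Qed.

Lemma le_covered S n m e e' : (n <= m)%N -> e <= e' -> covered S n e -> covered S m e'.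
Proof.
move=> nm ee' [s [sn cs]]; exists s; split; first exact: leq_trans nm.
by move=> y /cs[x xs xy]; exists x => //; exact: le_trans ee'.
Qed.

(** All combinations [a *: x1 + b *: x2] of centres serve as centres, so the numbers of balls
    multiply. *)
Lemma covered_add S S1 S2 n m a b e1 e2 : 0 <= a -> 0 <= b ->
  (forall y, S y -> exists y1 y2, [/\ S1 y1, S2 y2 & y = a *: y1 + b *: y2]) ->
  covered S1 n e1 -> covered S2 m e2 -> covered S (n * m) (a * e1 + b * e2).
Proof.
move=> a0 b0 dec [s1 [sn1 cs1]] [s2 [sn2 cs2]].
exists [seq a *: x1 + b *: x2 | x1 <- s1, x2 <- s2]; split.
  by rewrite size_allpairs leq_mul.
move=> _ /dec[y1 [y2 [/cs1[x1 x1s xy1] /cs2[x2 x2s xy2] ->]]].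
exists (a *: x1 + b *: x2); first exact: allpairs_f.
rewrite opprD addrACA -!scalerBr (le_trans (ler_normD _ _))// !normrZ.
by rewrite !ger0_norm// lerD// ler_wpM2l.
Qed.

Lemma covered_scale S S1 n a e : 0 <= a ->
  (forall y, S y -> exists2 y1, S1 y1 & y = a *: y1) ->
  covered S1 n e -> covered S n (a * e).
Proof.
move=> a0 dec [s [sn cs]]; exists [seq a *: x | x <- s]; split.
  by rewrite size_map.
move=> _ /dec[y1 /cs[x xs xy] ->]; exists (a *: x); first exact: map_f.
by rewrite -scalerBr normrZ ger0_norm// ler_wpM2l.
Qed.

Lemma covered_bounded S n e : covered S n e -> exists M, forall y, S y -> `|y| <= M.
Proof.
move=> [s [_ cs]]; exists (\sum_(x <- s) `|x| + e) => y /cs[x xs xy].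
have -> : y = x - (x - y) by rewrite subKr.
rewrite (le_trans (ler_normB _ _))// lerD//.
by rewrite (big_rem x xs)/= lerDl sumr_ge0.
Qed.

End covers.

Lemma lipschitz_covered (R : realType) (F F' : normedModType R) (J : F -> F')
    (S : set F) (S' : set F') n (c e : R) : 0 <= c ->
  (forall x y, `|J x - J y| <= c * `|x - y|) -> S' `<=` J @` S ->
  covered S n e -> covered S' n (c * e).
Proof.
move=> c0 lipJ S'S [s [sn cs]]; exists (map J s); split; first by rewrite size_map.
move=> _ /S'S[y /cs[x xs xy] <-]; exists (J x); first exact: map_f.
by rewrite (le_trans (lipJ _ _))// ler_wpM2l.
Qed.

(** * Entropy numbers and their rates in terms of covers *)

Section entropy_covers.
Context (R : realType) (E : Type) (F : normedModType R).
Variables (N : E -> \bar R) (T : E -> F).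
Local Notation TB := (T @` unit_ball N).

Lemma entropy_number_le n e : 0 < e -> covered TB (2 ^ n.-1) e ->
  (entropy_number N T n <= e%:E)%E.
Proof.
move=> e0 [s [sn cs]]; apply: ereal_inf_lbound; exists e => //; split => //.
(* Indices beyond the end of [s] give the harmless extra centre 0. *)
exists (fun i => nth 0 s i) => y /cs[x xs xy].
have xs' : (index x s < 2 ^ n.-1)%N by rewrite (leq_trans _ sn)// index_mem.
by exists (Ordinal xs') => //=; rewrite /closed_ball_/= nth_index.
Qed.

Lemma covered_balls n e (x : 'I_(2 ^ n.-1)%N -> F) :
  TB `<=` \bigcup_i closed_ball_ Num.norm (x i) e -> covered TB (2 ^ n.-1) e.
Proof.
move=> Tx; exists [seq x i | i <- enum 'I_(2 ^ n.-1)%N]; split.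
  by rewrite size_map size_enum_ord.
move=> y /Tx[i _ xi]; exists (x i) => //.
by apply: map_f; rewrite mem_enum.
Qed.

Lemma entropy_number_lt n e : (entropy_number N T n < e%:E)%E ->
  covered TB (2 ^ n.-1) e.
Proof.
move=> /ereal_inf_lt[_ [e' [e'0 [x /covered_balls cx]] <-]].
by rewrite lte_fin => /ltW ee'; exact: le_covered ee' cx.
Qed.

Lemma entropy_number_ge n r :
  (forall e, 0 < e -> covered TB (2 ^ n.-1) e -> r <= e) ->
  (r%:E <= entropy_number N T n)%E.
Proof.
move=> re; apply: le_ereal_inf_tmp => _ [e [e0 [x /covered_balls cx]] <-].
by rewrite lee_fin; exact: re.
Qed.

Lemma entropy_rate_covered (s : R) :
  asymp_le (entropy_number N T) (power_rate s) ->
  exists2 c, 0 < c & forall n, (1 <= n)%N ->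
    covered TB (2 ^ n.-1) (c * n%:R `^ s).
Proof.
(* Doubling the constant makes the inequality strict, so that the infimum yields a cover. *)
move=> [c [c0 ec]]; exists (2 * c); first by rewrite mulr_gt0.
move=> n n1; apply: entropy_number_lt; rewrite (le_lt_trans (ec n n1))//.
rewrite /power_rate -EFinM lte_fin -mulrA ltr_pMl ?ltr1n//.
by rewrite mulr_gt0// powR_gt0// ltr0n.
Qed.

(* A cover by [2 ^ (2 n - 2)] balls bounds the entropy number of index
   [2 n - 1]; only a constant is lost when passing to all indices. *)
Lemma covered_entropy_rate (s c : R) : 0 <= s -> 0 < c ->
  (forall n, (1 <= n)%N ->
    covered TB (2 ^ n.-1 * 2 ^ n.-1) (c * n%:R `^ (- s))) ->
  asymp_le (entropy_number N T) (power_rate (- s)).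
Proof.
move=> s0 c0 cc; exists (c * 2 `^ s); split; first by rewrite mulr_gt0// powR_gt0.
(* With [n] the upper half of [m], [2 * n <= m + 1] controls the number of balls, and [m <= 2 * n]
   costs only the factor [2 ^ s] in the radius. *)
move=> m m1; pose n := uphalf m.
have n1 : (1 <= n)%N by rewrite /n uphalf_gt0.
have nm : (m <= n.*2 <= m.+1)%N.
  move: (odd_double_half m.+1); rewrite -uphalfE -/n.
  case: (odd m.+1); first by rewrite add1n => -[->]; rewrite leqnn leqnSn.
  by rewrite add0n => ->; rewrite leqnn leqnSn.
have [m0 n0] : (0 : R) < m%:R /\ (0 : R) < n%:R by rewrite !ltr0n.
apply: entropy_number_le.
  by rewrite !mulr_gt0// powR_gt0.
apply: le_covered (cc n n1).
  rewrite -expnD leq_exp2l// addnn; case: n nm {n1 n0} => [|n]//=.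
  by rewrite doubleS ltnS => /andP[_]; case: m m1 {m0}.
rewrite -mulrA ler_wpM2l ?(ltW c0)//.
rewrite !powRN -invf_div lef_pV2 ?posrE ?divr_gt0 ?powR_gt0//.
rewrite ler_pdivrMr ?powR_gt0// -powRM ?ler0n//.
rewrite ge0_ler_powR ?nnegrE ?mulr_ge0 ?ler0n//.
by rewrite -natrM ler_nat muln2; case/andP: nm.
Qed.

(** A lower bound for an infimum is a statement about all covers, and in this form it applies to a
    cover built from other ones. *)
Lemma entropy_lower_rate (s : R) :
  asymp_le (power_rate s) (entropy_number N T) <->
  exists2 c, 0 < c & forall n e, (1 <= n)%N -> 0 < e ->
    covered TB (2 ^ n.-1) e -> c * n%:R `^ s <= e.
Proof.
split=> [[c [c0 ec]]|[c c0 ec]].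
  exists c^-1; rewrite ?invr_gt0// => n e n1 e0 ce.
  rewrite mulrC ler_pdivrMr// mulrC -lee_fin EFinM.
  apply: (le_trans (ec n n1)); rewrite lee_wpmul2l ?lee_fin ?(ltW c0)//.
  exact: entropy_number_le.
exists c^-1; rewrite ?invr_gt0//; split => // n n1.
rewrite -lee_pdivrMl ?invr_gt0// invrK -EFinM.
by apply: entropy_number_ge => e e0; exact: ec.
Qed.

End entropy_covers.

Lemma asymp_le_trans (R : realType) (a b c : nat -> \bar R) :
  asymp_le a b -> asymp_le b c -> asymp_le a c.
Proof.
move=> [r [r0 ab]] [s [s0 bc]]; exists (r * s); split; first by rewrite mulr_gt0.
move=> n n1; rewrite EFinM -muleA (le_trans (ab n n1))//.
by rewrite lee_wpmul2l ?lee_fin ?(ltW r0)// bc.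
Qed.

(** * Zero and scalar multiples under the inclusions *)

Section inclusion_scale.
Context d (X : measurableType d) (R : realType).
Variables (mu : {measure set X -> \bar R}) (p : \bar R) (p1 : (1 <= p)%E).

Lemma inclusion0 : inclusion p1 (0 : L2 mu) = 0.
Proof.
have L0 := (Lfun_submod_closed mu p1).1.
have E0 := Lclass_ofE (lee1n 2) (Lfun_submod_closed mu (lee1n 2)).1.
apply/Lspace_eqP; apply: (ae_eq_trans (LclassE p1 _)); last first.
  apply: (ae_eq_trans E0); apply: ae_eq_sym.
  exact: (Lclass_ofE p1 (Lfun_submod_closed mu p1).1).
apply: (Lfun_ae_eq p1 _ (ae_eq_sym E0)) => //; exact: Lspace_measurable.
Qed.

Lemma zero_Lfun : ((0 : L2 mu) : X -> R) \in Lfun mu p.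
Proof.
have E0 := Lclass_ofE (lee1n 2) (Lfun_submod_closed mu (lee1n 2)).1.
apply: (Lfun_ae_eq p1 _ (ae_eq_sym E0)); first exact: Lspace_measurable.
exact: (Lfun_submod_closed mu p1).1.
Qed.

Lemma inclusion_LfunZ a (g : L2 mu) : (g : X -> R) \in Lfun mu p ->
  ((a *: g : L2 mu) : X -> R) \in Lfun mu p.
Proof.
by move=> gL; rewrite -[a *: g]addr0; exact: (inclusion_Lfun p1 a gL zero_Lfun).
Qed.

Lemma inclusionZ a (g : L2 mu) : (g : X -> R) \in Lfun mu p ->
  inclusion p1 (a *: g) = a *: inclusion p1 g.
Proof.
move=> gL; rewrite -[a *: g]addr0 (inclusionDZ p1 a gL zero_Lfun).
by rewrite inclusion0 addr0.
Qed.

End inclusion_scale.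

(** * Boundedness of L_oo -> L_2 for a finite measure *)

Section finite_measure.
Context d (X : measurableType d) (R : realType).
Variables (mu : {finite_measure set X -> \bar R}).

Lemma Lfun_infty_sub : {subset Lfun mu +oo <= Lfun mu 2%:E}.
Proof.
apply: Lfun_subset => //; [exact: lee1n|exact: leey| |exact: leey].
exact: fin_num_measure.
Qed.

(** The square of [f] is almost everywhere at most [M ^ 2], which is integrated over the space. The
    summand 1 keeps the constant positive even for the zero measure. *)
Lemma Lnorm2_le_infty (f : X -> R) (M : R) : measurable_fun [set: X] f ->
  ('N[mu]_+oo[EFin \o f] <= M%:E)%E ->
  ('N[mu]_2[EFin \o f] <= ((Num.sqrt (fine (mu [set: X])) + 1) * M)%:E)%E.
Proof.
move=> mf fM.
have M0 : 0 <= M by rewrite -lee_fin (le_trans _ fM)// Lnorm_ge0.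
have fm : mu [set: X] \is a fin_num by exact: fin_num_measure.
have aeM : \forall x \ae mu, `|f x| <= M.
  (* For the zero measure the L_oo norm carries no information on [f], but every property holds
     almost everywhere. *)
  have [mu0|mu0] := ltP 0%E (mu [set: X]).
    move: fM; rewrite unlock mu0 => /ess_supP; apply: filterS => x /=.
    by rewrite lee_fin.
  exists [set: X]; split => //.
  by apply/eqP; rewrite eq_le mu0 measure_ge0.
apply: (@le_trans _ _ (((M ^+ 2)%:E * mu [set: X]) `^ 2^-1)%E).
  rewrite unlock /=; apply: gt0_ler_poweR => //.
  - by rewrite in_itv/= leey andbT; apply: integral_ge0 => x _; rewrite lee_fin powR_ge0.
  - by rewrite in_itv/= leey andbT mule_ge0// lee_fin sqr_ge0.
  - rewrite -integral_cst//; apply: ae_ge0_le_integral => //.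
    + apply/measurable_EFinP.
      apply: (@measurableT_comp _ _ _ _ _ _ (@powR R ^~ 2)) => //.
      exact: measurableT_comp.
    + by move=> x _; rewrite lee_fin sqr_ge0.
    + apply: filterS aeM => x /= xM _; rewrite lee_fin powR_mulrn//.
      by rewrite ler_pXn2r ?nnegrE.
rewrite -(fineK fm) -EFinM poweR_EFin lee_fin powR12_sqrt ?mulr_ge0 ?sqr_ge0 ?fine_ge0//.
rewrite sqrtrM ?sqr_ge0// sqrtr_sqr ger0_norm// mulrC ler_wpM2r//.
by rewrite lerDl.
Qed.

Lemma Lclass2_lipschitz (x y : LspaceType mu (leey 1)) :
  `|Lclass mu (lee1n 2) x - Lclass mu (lee1n 2) y| <=
  (Num.sqrt (fine (mu [set: X])) + 1) * `|x - y|.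
Proof.
have L2x (z : LspaceType mu (leey 1)) := Lfun_infty_sub (Lspace_Lfun z).
have -> : Lclass mu (lee1n 2) x - Lclass mu (lee1n 2) y =
    Lclass mu (lee1n 2) (x - y : LspaceType mu (leey 1)).
  rewrite addrC -scaleN1r -LclassDZ//; apply: Lclass_ae_eq => //.
    exact: (Lfun_add (lee1n 2) (Lfun_scaler (lee1n 2) _ (L2x y)) (L2x x)).
  rewrite [x - y]addrC -[- y]scaleN1r.
  have ED := Lspace_addE (-1 *: y) x; have EZ := Lspace_scaleE (-1) y.
  near=> z => _.
  by rewrite (near ED z)//= (near EZ z).
rewrite -lee_fin Lspace_norm_fin.
rewrite (Lnorm_ae_eq (lee1n 2) _ _ (LclassE (lee1n 2) (L2x (x - y)))).
- by apply: Lnorm2_le_infty; [exact: Lspace_measurable|rewrite -Lspace_norm_fin].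
- exact: Lspace_measurable.
- exact: Lspace_measurable.
Unshelve. all: by end_near. Qed.

(** The inclusion into L_2 factors through L_oo by the Lipschitz map of [Lclass2_lipschitz]. *)
Lemma covered_infty_2 (N : L2 mu -> \bar R) n (e : R) :
  subspace_of_Lp N +oo -> covered (inclusion (leey 1) @` unit_ball N) n e ->
  covered (inclusion (lee1n 2) @` unit_ball N) n
    ((Num.sqrt (fine (mu [set: X])) + 1) * e).
Proof.
move=> sub; apply: (@lipschitz_covered _ _ _
    (fun x : LspaceType mu (leey 1) => Lclass mu (lee1n 2) x)).
- by rewrite addr_ge0// sqrtr_ge0.
- exact: Lclass2_lipschitz.
move=> _ [g g1 <-]; exists (inclusion (leey 1) g); first by exists g.
have gL : (g : X -> R) \in Lfun mu +oo by apply: sub; rewrite (le_lt_trans g1)// ltry.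
apply: Lclass_ae_eq; last exact: LclassE.
  exact/Lfun_infty_sub/Lspace_Lfun.
exact: Lspace_Lfun.
Qed.

End finite_measure.

(** * Embeddings and covers of the unit balls of interpolation spaces *)

Section interpolation_covers.
Context d (X : measurableType d) (R : realType).
Variables (mu : {measure set X -> \bar R}).
Variables (H : hilbertType R) (ev : {linear H -> (X -> R)}).
Local Notation q := (quotient_norm mu ev).
Local Notation N := (interp_norm mu ev).
Local Notation ball theta := (unit_ball (interp_norm mu ev theta)).

Lemma interp_norm1 : N 1 = q.
Proof. by apply/funext => g; rewrite /interp_norm eqxx. Qed.

Lemma unit_ball_normalize theta g (r : R) : 0 < r -> (N theta g <= r%:E)%E ->
  ball theta (r^-1 *: g).
Proof.
move=> r0 gr; rewrite /unit_ball/=; apply: (le_trans (interp_normZ _ gr)).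
by rewrite gtr0_norm ?invr_gt0// mulVf// gt_eqF.
Qed.

Lemma finite_normalize theta g : (N theta g < +oo)%E ->
  exists2 r : R, 0 < r & ball theta (r^-1 *: g).
Proof.
move=> gfin; have g0 := interp_norm_ge0 ev theta g.
have gf : N theta g \is a fin_num by rewrite ge0_fin_numE.
have r0 : 0 < fine (N theta g) + 1 by rewrite ltr_wpDl// fine_ge0.
exists (fine (N theta g) + 1) => //; apply: unit_ball_normalize => //.
by rewrite EFinD fineK// leeDl.
Qed.

Lemma interp_norm_lty theta g : 0 < theta <= 1 -> (q g < +oo)%E ->
  (N theta g < +oo)%E.
Proof.
move=> th qg; have q0 := quotient_norm_ge0 ev g.
have qf : q g \is a fin_num by rewrite ge0_fin_numE.
have r0 : 0 < fine (q g) + 1 by rewrite ltr_wpDl// fine_ge0.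
have A0 : 0 < `|g| + 1 by rewrite ltr_wpDl.
apply: (le_lt_trans (interp_norm_interpolation th A0 r0 _ _)); last exact: ltry.
  by rewrite lerDl.
by rewrite EFinD fineK// leeDl.
Qed.

(** An element of H_gamma is, after normalization, the sum of one of H_beta and one of [H]_~, and
    both spaces lie in L_p. *)
Lemma subspace_of_Lp_mono beta gamma (p : \bar R) (p1 : (1 <= p)%E) :
  0 < beta -> beta <= gamma <= 1 ->
  subspace_of_Lp (N beta) p -> subspace_of_Lp (N gamma) p.
Proof.
move=> b0 /andP[+ g1] subb; rewrite le_eqVlt => /predU1P[<-//|bg].
have b1 : beta < 1 by exact: lt_le_trans g1.
have sub1 g : (q g < +oo)%E -> (g : X -> R) \in Lfun mu p.
  by move=> qg; apply: subb; apply: interp_norm_lty => //; rewrite b0 ltW.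
move: g1; rewrite le_eqVlt => /predU1P[->|g1]; first by rewrite interp_norm1.
move=> g /finite_normalize[r r0 g'1].
(* Only membership is at stake, so the parameter 1 is as good as any other. *)
have [h [qh Nh]] := interp_decomposition b0 bg g1 g'1 ltr01.
have -> : g = r *: (1 *: (r^-1 *: g - h) + h).
  by rewrite scale1r subrK scalerA divff ?scale1r// gt_eqF.
apply: (inclusion_LfunZ p1); apply: inclusion_Lfun => //.
  by apply: subb; rewrite (le_lt_trans Nh)// ltry.
by apply: sub1; rewrite (le_lt_trans qh)// ltry.
Qed.

(** A finite cover bounds the image of the unit ball, and homogeneity extends the bound to the whole
    space. *)
Lemma covered_continuously_embedded theta (p : \bar R) (p1 : (1 <= p)%E) n e :
  subspace_of_Lp (N theta) p -> covered (inclusion p1 @` ball theta) n e ->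
  continuously_embedded (N theta) p1.
Proof.
move=> sub /covered_bounded[M HM]; split => //; exists (Num.max M 0) => g gfin.
have M0 : 0 <= Num.max M 0 by rewrite le_max lexx orbT.
have g0 := interp_norm_ge0 ev theta g.
have gf : N theta g \is a fin_num by rewrite ge0_fin_numE.
apply/lee_addgt0Pr => e' e'0; rewrite -(fineK gf) -EFinM -EFinD lee_fin.
(* The norm may vanish, so [r] is taken slightly larger; [r * M'] then exceeds the desired bound by
   at most [e']. *)
set M' := Num.max M 0 in M0 *; pose r := fine (N theta g) + e' / (M' + 1).
have M1 : 0 < M' + 1 by rewrite ltr_wpDl.
have r0 : 0 < r by rewrite ltr_wpDl ?fine_ge0// divr_gt0.
have /HM : (inclusion p1 @` ball theta) (inclusion p1 (r^-1 *: g)).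
  exists (r^-1 *: g) => //; apply: unit_ball_normalize => //.
  by rewrite EFinD fineK// leeDl// lee_fin divr_ge0 ?(ltW e'0) ?(ltW M1).
rewrite (inclusionZ p1 _ (sub g gfin)) normrZ gtr0_norm ?invr_gt0//.
rewrite ler_pdivrMl// => le1; apply: (le_trans le1).
apply: (@le_trans _ _ (r * M')).
  by rewrite ler_wpM2l ?(ltW r0)// le_max lexx.
rewrite /r mulrDl [_ * M']mulrC lerD2l mulrAC ler_pdivrMr// ler_wpM2l ?(ltW e'0)//.
by rewrite lerDl.
Qed.

(** Two elements of B_1 in the same L_2 ball differ by at most [2 * A] in L_2 and by at most 2 in
    the quotient norm, so by [interp_norm_interpolation] their difference lies in [rho] times
    B_theta, whose cover is then rescaled and translated. *)
Lemma covered_interpolation theta (p : \bar R) (p1 : (1 <= p)%E) n m (A e : R) :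
  0 < theta <= 1 -> 0 < A -> 0 <= e -> subspace_of_Lp (N theta) p ->
  covered (inclusion (lee1n 2) @` ball 1) n A ->
  covered (inclusion p1 @` ball theta) m e ->
  covered (inclusion p1 @` ball 1) (n * m)
    (interp_const theta 1 * (2 * A `^ (1 - theta)) * e).
Proof.
move=> /[dup] th /andP[th0 th1] A0 e0 sub [s [sn cs]] [s' [sn' cs']].
have sub1 g : (q g < +oo)%E -> (g : X -> R) \in Lfun mu p.
  by move=> qg; apply: sub; exact: interp_norm_lty.
pose rho := interp_const theta 1 * (2 * A `^ (1 - theta)).
have rho0 : 0 < rho.
  by rewrite !mulr_gt0 ?powR_gt0// (lt_le_trans ltr01)// interp_const_ge1.
have rhoE : rho = interp_const theta 1 * ((2 * A) `^ (1 - theta) * 2 `^ theta).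
  rewrite powRM ?(ltW A0)// mulrAC -powRD ?subrK ?powRr1//.
  by apply/implyP.
have A2 : 2 * A = A + A by rewrite mulr_natl mulr2n.
(* The centre [x] need not lie in B_1, so each ball is recentred at an element of B_1 that it
   contains; the default 0 occurs only for balls that miss B_1. *)
pose z x := xget 0 [set z : L2 mu | (q z <= 1)%E /\ `|x - z| <= A].
exists [seq inclusion p1 (z x) + rho *: y | x <- s, y <- s']; split.
  by rewrite size_allpairs leq_mul.
move=> _ [g g1 <-]; move: (g1); rewrite /unit_ball/= interp_norm1 => qg.
have [|x xs xg] := cs g; first by exists g => //; rewrite /inclusion LclassK.
have [qz xz] : (q (z x) <= 1)%E /\ `|x - z x| <= A.
  by apply: (xgetPex 0 (P := [set z : L2 mu | (q z <= 1)%E /\ `|x - z| <= A])); exists g.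
pose w := rho^-1 *: (g - z x).
have w1 : ball theta w.
  apply: unit_ball_normalize => //; rewrite rhoE.
  have -> : g - z x = -1 *: z x + g by rewrite scaleN1r addrC.
  apply: interp_norm_interpolation => //; rewrite ?mulr_gt0//.
    rewrite scaleN1r addrC -(subrK x g) -addrA (le_trans (ler_normD _ _))//.
    by rewrite A2 distrC lerD.
  by have := quotient_normDZ (-1) qz qg; rewrite normrN1 mul1r.
have [|y ys yw] := cs' (inclusion p1 w); first by exists w.
exists (inclusion p1 (z x) + rho *: y).
  by apply: (allpairs_f (fun x y => inclusion p1 (z x) + rho *: y)).
have -> : g = rho *: w + z x.
  by rewrite /w scalerA divff ?gt_eqF// scale1r subrK.
rewrite inclusionDZ; last 2 first.
- by apply: sub; rewrite (le_lt_trans w1)// ltry.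
- by apply: sub1; rewrite (le_lt_trans qz)// ltry.
rewrite [inclusion p1 (z x) + _]addrC opprD addrACA subrr addr0 -scalerBr normrZ.
by rewrite gtr0_norm// ler_wpM2l// ltW.
Qed.

(** By [interp_decomposition], B_gamma lies in [a] times B_beta plus [b] times B_1, and
    [covered_add] adds up the covers. *)
Lemma covered_intermediate beta gamma (p : \bar R) (p1 : (1 <= p)%E) n m
    (e1 e2 t : R) :
  0 < beta -> beta < gamma -> gamma < 1 -> 0 < t -> subspace_of_Lp (N beta) p ->
  covered (inclusion p1 @` ball beta) n e1 ->
  covered (inclusion p1 @` ball 1) m e2 ->
  covered (inclusion p1 @` ball gamma) (n * m)
    (interp_const beta gamma * (9 * t `^ (gamma - beta)) * e1 +
     5 * t `^ (gamma - 1) * e2).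
Proof.
move=> b0 bg g1 t0 sub; have b1 : beta <= 1 by rewrite ltW// (lt_trans bg).
set a := interp_const _ _ * _; set b := 5 * _.
have a0 : 0 < a.
  by rewrite !mulr_gt0 ?powR_gt0// (lt_le_trans ltr01)// interp_const_ge1// ltW.
have b'0 : 0 < b by rewrite mulr_gt0// powR_gt0.
apply: covered_add; [exact: ltW|exact: ltW|].
have dec g : ball gamma g ->
    exists h, (q h <= b%:E)%E /\ (N beta (g - h)%R <= a%:E)%E.
  by move=> gball; exact: interp_decomposition.
clearbody a b => _ [g gball <-]; have [h [qh Nh]] := dec g gball.
have hL : (h : X -> R) \in Lfun mu p.
  apply: sub; apply: interp_norm_lty; first by rewrite b0.
  by rewrite (le_lt_trans qh)// ltry.
have ghL : ((g - h : L2 mu) : X -> R) \in Lfun mu p.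
  by apply: sub; rewrite (le_lt_trans Nh)// ltry.
exists (inclusion p1 (a^-1 *: (g - h))), (inclusion p1 (b^-1 *: h)); split.
- exists (a^-1 *: (g - h)); last by [].
  exact: unit_ball_normalize.
- exists (b^-1 *: h); last by [].
  by apply: unit_ball_normalize => //; rewrite interp_norm1.
rewrite !inclusionZ// !scalerA !divff ?gt_eqF// !scale1r.
by rewrite -[X in X + _]scale1r -inclusionDZ// scale1r subrK.
Qed.

End interpolation_covers.

(** * The image of the unit ball of H against that of [H]_~ *)

Section quotient_image.
Context d (X : measurableType d) (R : realType).
Variables (mu : {finite_measure set X -> \bar R}).
Variables (H : hilbertType R) (ev : {linear H -> (X -> R)}).
Variables (p : \bar R) (p1 : (1 <= p)%E).
Hypothesis Lp_sub_L2 : {subset Lfun mu p <= Lfun mu 2%:E}.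
Hypothesis quotient_sub_Lp : subspace_of_Lp (interp_norm mu ev 1) p.
Local Notation ballH := (unit_ball (fun f : H => `|f|%:E)).
Local Notation ball1 := (unit_ball (interp_norm mu ev 1)).

Lemma Ikmu_image_sub : Ikmu mu ev p1 @` ballH `<=` inclusion p1 @` ball1.
Proof.
move=> _ [f f1 <-].
(* If [ev f] is not in L_2 then it is not in L_p either, and [Lclass] takes its default value 0,
   which is the image of 0. *)
have [fL2|fL2] := boolP (ev f \in Lfun mu 2%:E); last first.
  exists 0; first by rewrite /unit_ball/= interp_norm1 quotient_norm0.
  rewrite inclusion0 /Ikmu /Lclass; case: pselect => // fL.
  by exfalso; have := Lp_sub_L2 fL; rewrite (negPf fL2).
pose g := Lclass mu (lee1n 2) (ev f).
have fg : (g : X -> R) = ev f %[ae mu] by exact: LclassE.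
have g1 : ball1 g.
  rewrite /unit_ball/= interp_norm1; apply: le_trans f1.
  exact/quotient_norm_le/ae_eq_sym.
have gL : (g : X -> R) \in Lfun mu p.
  by apply: quotient_sub_Lp; rewrite (le_lt_trans g1)// ltry.
exists g => //; apply: Lclass_ae_eq => //.
by apply: (Lfun_ae_eq p1 _ fg gL); exact: Lfun_measurable fL2.
Qed.

(* Completeness of [mu] makes [ev f] measurable as soon as it agrees almost
   everywhere with a measurable function. *)
Lemma inclusion_image_sub : measure_is_complete mu ->
  forall y, (inclusion p1 @` ball1) y ->
  exists2 y1, (Ikmu mu ev p1 @` ballH) y1 & y = 2 *: y1.
Proof.
move=> cmu _ [g g1 <-].
have gL : (g : X -> R) \in Lfun mu p.
  by apply: quotient_sub_Lp; rewrite (le_lt_trans g1)// ltry.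
move: g1; rewrite /unit_ball/= interp_norm1 => qg.
(* The quotient norm need not be attained: a preimage of norm less than 2 is taken, whence the
   factor 2. *)
have [|f f2 fg] := @quotient_norm_lt _ _ _ mu H ev g 2.
  by rewrite (le_lt_trans qg)// lte_fin ltr1n.
have mf : measurable_fun [set: X] (ev f).
  apply/measurable_EFinP; apply: (ae_measurable_fun cmu (f := EFin \o (g : X -> R))).
    by apply: filterS fg => x /= fg _; rewrite /= fg.
  by apply/measurable_EFinP; exact: Lspace_measurable.
have fL : ev f \in Lfun mu p by apply: (Lfun_ae_eq p1 mf (ae_eq_sym fg) gL).
have evE : ev (2^-1 *: f) = 2^-1 \*: ev f by rewrite linearZ.
exists (Ikmu mu ev p1 (2^-1 *: f)).
  exists (2^-1 *: f) => //; rewrite /unit_ball/= lee_fin normrZ gtr0_norm//.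
  by rewrite ler_pdivrMl// mulr1 ltW.
rewrite /Ikmu evE LclassZ//.
rewrite scalerA divff// scale1r; apply: Lclass_ae_eq => //.
exact: ae_eq_sym.
Qed.

Lemma covered_Ikmu n e : covered (inclusion p1 @` ball1) n e ->
  covered (Ikmu mu ev p1 @` ballH) n e.
Proof. exact/sub_covered/Ikmu_image_sub. Qed.

Lemma covered_inclusion n e : measure_is_complete mu ->
  covered (Ikmu mu ev p1 @` ballH) n e ->
  covered (inclusion p1 @` ball1) n (2 * e).
Proof. by move=> cmu; apply: covered_scale => //; exact: inclusion_image_sub. Qed.

End quotient_image.

(** * Rates of entropy numbers along the interpolation scale *)

Section rates.
Context d (X : measurableType d) (R : realType).
Variables (mu : {measure set X -> \bar R}).
Variables (H : hilbertType R) (ev : {linear H -> (X -> R)}).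
Local Notation N := (interp_norm mu ev).
Variable s : R.
Hypothesis s0 : 0 <= s.

(* [n ^ (- s)] plays the role of the parameter [t] of the K-functional. *)
Let rate_pow n (u : R) : (n%:R `^ (- s) : R) `^ u = n%:R `^ (- (s * u)).
Proof. by rewrite -powRrM mulNr. Qed.

(** The L_2 cover contributes [n ^ (- s * (1 - theta))] and the cover of B_theta
    [n ^ (- s * theta)]; the exponents add up to [- s]. *)
Lemma interpolation_rate theta (p : \bar R) (p1 : (1 <= p)%E) :
  0 < theta <= 1 -> subspace_of_Lp (N theta) p ->
  asymp_le (entropy_inclusion (N 1) (lee1n 2)) (power_rate (- s)) ->
  asymp_le (entropy_inclusion (N theta) p1) (power_rate (- (s * theta))) ->
  asymp_le (entropy_inclusion (N 1) p1) (power_rate (- s)).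
Proof.
move=> /[dup] th /andP[th0 th1] sub /entropy_rate_covered[c c0 cov1].
move=> /entropy_rate_covered[c' c'0 covt].
have C0 : 0 < interp_const theta 1.
  by rewrite (lt_le_trans ltr01)// interp_const_ge1.
rewrite /entropy_inclusion; apply: (@covered_entropy_rate _ _ _ _ _ _
    (interp_const theta 1 * (2 * c `^ (1 - theta)) * c')); first by [].
  by rewrite !mulr_gt0 ?powR_gt0.
move=> n n1; have n0 : (0 : R) < n%:R by rewrite ltr0n.
have A0 : 0 < c * n%:R `^ (- s) by rewrite mulr_gt0// powR_gt0.
have e0 : 0 <= c' * n%:R `^ (- (s * theta)) by rewrite mulr_ge0 ?powR_ge0// ltW.
apply: le_covered (covered_interpolation th A0 e0 sub (cov1 n n1) (covt n n1)) => //.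
rewrite powRM ?powR_ge0 ?(ltW c0)// rate_pow.
have -> : - s = - (s * (1 - theta)) - s * theta by ring.
by rewrite (@powRD_gt0 _ n%:R)// le_eqVlt; apply/orP; left; apply/eqP; ring.
Qed.

(** At [t = n ^ (- s)] the two terms of [covered_intermediate] balance: both are of order
    [n ^ (- s * gamma)]. *)
Lemma intermediate_rate beta gamma (p : \bar R) (p1 : (1 <= p)%E) :
  0 < beta -> beta < gamma -> gamma < 1 -> subspace_of_Lp (N beta) p ->
  asymp_le (entropy_inclusion (N beta) p1) (power_rate (- (s * beta))) ->
  asymp_le (entropy_inclusion (N 1) p1) (power_rate (- s)) ->
  asymp_le (entropy_inclusion (N gamma) p1) (power_rate (- (s * gamma))).
Proof.
move=> b0 bg g1 sub /entropy_rate_covered[c c0 covb].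
move=> /entropy_rate_covered[c' c'0 cov1].
have C0 : 0 < interp_const beta gamma.
  by rewrite (lt_le_trans ltr01)// interp_const_ge1// ltW.
rewrite /entropy_inclusion; apply: (@covered_entropy_rate _ _ _ _ _ _
    (interp_const beta gamma * 9 * c + 5 * c')).
- by rewrite mulr_ge0// ltW// (lt_trans b0).
- by rewrite addr_gt0 ?mulr_gt0.
move=> n n1; have n0 : (0 : R) < n%:R by rewrite ltr0n.
have t0 : 0 < (n%:R : R) `^ (- s) by rewrite powR_gt0.
apply: le_covered (covered_intermediate b0 bg g1 t0 sub (covb n n1) (cov1 n n1)) => //.
rewrite !rate_pow.
have -> : - (s * gamma) = - (s * (gamma - beta)) - s * beta by ring.
have -> : (5 * n%:R `^ (- (s * (gamma - 1))) * (c' * n%:R `^ (- s)) : R) =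
    5 * c' * n%:R `^ (- (s * (gamma - beta)) - s * beta).
  have -> : - (s * (gamma - beta)) - s * beta = - (s * (gamma - 1)) - s by ring.
  by rewrite (@powRD_gt0 _ n%:R)//; ring.
by rewrite (@powRD_gt0 _ n%:R)// le_eqVlt; apply/orP; left; apply/eqP; ring.
Qed.

(** With L_2 as target, a cover of B_theta of radius [e] gives one of B_1 of radius a multiple of
    [n ^ (- s * (1 - theta)) * e]; the lower bound for B_1 then bounds [e] from below. *)
Lemma lower_rate theta : 0 < theta <= 1 ->
  asymp_le (entropy_inclusion (N 1) (lee1n 2)) (power_rate (- s)) ->
  asymp_le (power_rate (- s)) (entropy_inclusion (N 1) (lee1n 2)) ->
  asymp_le (power_rate (- (s * theta))) (entropy_inclusion (N theta) (lee1n 2)).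
Proof.
move=> /[dup] th /andP[th0 th1] /entropy_rate_covered[c c0 cov1].
move=> /entropy_lower_rate[c' c'0 low]; apply/entropy_lower_rate.
have sub : subspace_of_Lp (N theta) 2 by move=> g _; exact: Lspace_Lfun.
have C0 : 0 < interp_const theta 1.
  by rewrite (lt_le_trans ltr01)// interp_const_ge1.
pose D := interp_const theta 1 * (2 * c `^ (1 - theta)).
have D0 : 0 < D by rewrite !mulr_gt0 ?powR_gt0.
exists (c' * 2 `^ (- s) / D); first by rewrite divr_gt0// mulr_gt0// powR_gt0.
move=> [//|j] e n1 e0 cove; set n := j.+1 in n1 cove *.
have n0 : (0 : R) < n%:R by rewrite ltr0n.
have A0 : 0 < c * n%:R `^ (- s) by rewrite mulr_gt0// powR_gt0.
have := covered_interpolation th A0 (ltW e0) sub (cov1 n n1) cove.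
rewrite powRM ?powR_ge0 ?(ltW c0)// rate_pow => cov.
(* For [n = j + 1] the product of the two covers has index [m = 2 * n - 1], and [m <= 2 * n] costs
   only the factor [2 ^ (- s)]. *)
pose m := j.*2.+1; have m1 : (1 <= m)%N by [].
have mE : (2 ^ n.-1 * 2 ^ n.-1 = 2 ^ m.-1)%N by rewrite -expnD addnn.
rewrite mE in cov; have m0 : (0 : R) < m%:R by rewrite ltr0n.
have {}low := low m _ m1 _ cov.
have {}low : c' * m%:R `^ (- s) <= D * n%:R `^ (- (s * (1 - theta))) * e.
  apply: (le_trans (low _)).
    by rewrite !mulr_gt0 ?powR_gt0.
  by rewrite /D le_eqVlt; apply/orP; left; apply/eqP; ring.
have mn : 2 `^ (- s) * n%:R `^ (- s) <= m%:R `^ (- s).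
  rewrite -powRM ?ler0n// !powRN lef_pV2 ?posrE ?powR_gt0 ?mulr_gt0//.
  rewrite ge0_ler_powR ?nnegrE ?mulr_ge0 ?ler0n//.
  by rewrite -natrM ler_nat mul2n doubleS leqnSn.
have E : (n%:R : R) `^ (- s) = n%:R `^ (- (s * (1 - theta))) * n%:R `^ (- (s * theta)).
  by rewrite -powRD_gt0//; congr (_ `^ _); ring.
have Y0 : 0 < (n%:R : R) `^ (- (s * (1 - theta))) by rewrite powR_gt0.
rewrite mulrAC ler_pdivrMr// -(ler_pM2l Y0).
have := le_trans (ler_wpM2l (ltW c'0) mn) low; rewrite E => le1.
apply: le_trans (le_trans le1 _).
  by rewrite le_eqVlt; apply/orP; left; apply/eqP; ring.
by rewrite le_eqVlt; apply/orP; left; apply/eqP; ring.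
Qed.

End rates.

(** * Comparison of entropy numbers for H and [H]_~, and for L_2 and L_oo *)

Section Ikmu_rates.
Context d (X : measurableType d) (R : realType).
Variables (mu : {finite_measure set X -> \bar R}).
Variables (H : hilbertType R) (ev : {linear H -> (X -> R)}).
Variables (p : \bar R) (p1 : (1 <= p)%E).
Hypothesis Lp_sub_L2 : {subset Lfun mu p <= Lfun mu 2%:E}.
Hypothesis quotient_sub_Lp : subspace_of_Lp (interp_norm mu ev 1) p.
Hypothesis complete_mu : measure_is_complete mu.

Lemma entropy_Ikmu_le :
  asymp_le (entropy_Ikmu mu ev p1) (entropy_inclusion (interp_norm mu ev 1) p1).
Proof.
exists 1; split => // n n1; rewrite mul1e.
apply: le_ereal_inf_tmp => _ [e [e0 [x /covered_balls cx]] <-].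
by apply: entropy_number_le => //; exact: covered_Ikmu.
Qed.

Lemma entropy_inclusion_le :
  asymp_le (entropy_inclusion (interp_norm mu ev 1) p1) (entropy_Ikmu mu ev p1).
Proof.
exists 2; split => // n n1; rewrite -lee_pdivrMl//.
apply: le_ereal_inf_tmp => _ [e [e0 [x /covered_balls cx]] <-].
rewrite lee_pdivrMl// -EFinM.
by apply: entropy_number_le; [rewrite mulr_gt0|exact: covered_inclusion].
Qed.

End Ikmu_rates.

Lemma entropy_inclusion_2_infty d (X : measurableType d) (R : realType)
    (mu : {finite_measure set X -> \bar R}) (N : L2 mu -> \bar R) :
  subspace_of_Lp N +oo ->
  asymp_le (entropy_inclusion N (lee1n 2)) (entropy_inclusion N (leey 1)).
Proof.
move=> sub; pose c := Num.sqrt (fine (mu [set: X])) + 1.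
have c0 : 0 < c by rewrite ltr_wpDl// sqrtr_ge0.
exists c; split => // n n1; rewrite -lee_pdivrMl//.
apply: le_ereal_inf_tmp => _ [e [e0 [x /covered_balls cx]] <-].
rewrite lee_pdivrMl// -EFinM.
by apply: entropy_number_le; [rewrite mulr_gt0|exact: covered_infty_2].
Qed.

(** * Assembly of the upper and lower rates *)

Theorem theorem4p4 (R : realType) (d : measure_display) (X : measurableType d)
    (mu : {finite_measure set X -> \bar R})
    (H : hilbertType R) (ev : {linear H -> (X -> R)}) (k : X -> X -> R)
    (alpha beta : R)
    (rkhs_H : is_rkhs ev k)
    (bounded_k : exists M : R, forall x y : X, `|k x y| <= M)
    (measurable_k : measurable_fun [set: X * X] (fun z : X * X => k z.1 z.2))
    (complete_mu : measure_is_complete mu)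
    (alpha_range : 0 < alpha < 2)
    (entropy_H : asymp_eq (entropy_Ikmu mu ev (lee1n 2)) (power_rate (- (1 / alpha))))
    (beta_range : alpha / 2 < beta <= 1)
    (compact_beta : compactly_embedded (interp_norm mu ev beta) (leey 1))
    (entropy_beta : asymp_le
       (entropy_inclusion (interp_norm mu ev beta) (leey 1))
       (power_rate (- (beta / alpha)))) :
  (forall gamma : R, beta <= gamma <= 1 ->
    [/\ continuously_embedded (interp_norm mu ev gamma) (leey 1),
        continuously_embedded (interp_norm mu ev gamma) (lee1n 2),
        asymp_eq (entropy_inclusion (interp_norm mu ev gamma) (leey 1))
                 (entropy_inclusion (interp_norm mu ev gamma) (lee1n 2)) &
        asymp_eq (entropy_inclusion (interp_norm mu ev gamma) (lee1n 2))
                 (power_rate (- (gamma / alpha)))]) /\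
  asymp_eq (entropy_Ikmu mu ev (leey 1)) (power_rate (- (1 / alpha))).
Proof.
have /andP[alpha0 _] := alpha_range; have /andP[betaL beta1] := beta_range.
have beta0 : 0 < beta by rewrite (lt_trans _ betaL)// divr_gt0.
have b1 : 0 < beta <= 1 by rewrite beta0.
pose s := alpha^-1; have s0 : 0 <= s by rewrite invr_ge0 ltW.
have rateE g : g / alpha = s * g by rewrite mulrC.
rewrite !rateE mulr1 in entropy_H entropy_beta *.
have [sub_beta _] := compact_beta.
have sub gamma : beta <= gamma <= 1 -> subspace_of_Lp (interp_norm mu ev gamma) +oo.
  by move=> bg; exact: (subspace_of_Lp_mono (leey 1) beta0 bg sub_beta).
have sub2 gamma : subspace_of_Lp (interp_norm mu ev gamma) 2.
  by move=> g _; exact: Lspace_Lfun.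
have Lsub2 : {subset Lfun mu 2%:E <= Lfun mu 2%:E} by [].
have Lsub : {subset Lfun mu +oo <= Lfun mu 2%:E} := @Lfun_infty_sub _ _ _ mu.
have sub1 : subspace_of_Lp (interp_norm mu ev 1) +oo by apply: sub; rewrite beta1 lexx.
have [upH lowH] := entropy_H.
have up2 : asymp_le (entropy_inclusion (interp_norm mu ev 1) (lee1n 2))
    (power_rate (- s)).
  exact: asymp_le_trans (entropy_inclusion_le (lee1n 2) (sub2 1) complete_mu) upH.
have low2 : asymp_le (power_rate (- s))
    (entropy_inclusion (interp_norm mu ev 1) (lee1n 2)).
  exact: asymp_le_trans lowH (entropy_Ikmu_le (lee1n 2) Lsub2 (sub2 1)).
(* Interpolation with [theta = beta] and target L_oo gives the endpoint [gamma = 1]. *)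
have up1 : asymp_le (entropy_inclusion (interp_norm mu ev 1) (leey 1)) (power_rate (- s)).
  exact: (interpolation_rate s0 b1 sub_beta up2 entropy_beta).
have up gamma : beta <= gamma <= 1 ->
    asymp_le (entropy_inclusion (interp_norm mu ev gamma) (leey 1))
      (power_rate (- (s * gamma))).
  (* The endpoints are the assumption on [beta] and [up1]; the decomposition handles what lies
     strictly between. *)
  move=> /andP[]; rewrite le_eqVlt => /predU1P[<-//|bg].
  rewrite le_eqVlt => /predU1P[->|g1]; first by rewrite mulr1.
  exact: (intermediate_rate s0 beta0 bg g1 sub_beta entropy_beta up1).
have low gamma : beta <= gamma <= 1 -> asymp_le (power_rate (- (s * gamma)))
    (entropy_inclusion (interp_norm mu ev gamma) (lee1n 2)).
  by move=> /andP[bg g1]; apply: lower_rate => //; rewrite g1 (lt_le_trans beta0).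
have le2y gamma : beta <= gamma <= 1 ->
    asymp_le (entropy_inclusion (interp_norm mu ev gamma) (lee1n 2))
      (entropy_inclusion (interp_norm mu ev gamma) (leey 1)).
  by move=> bg; exact/entropy_inclusion_2_infty/sub.
split=> [gamma bg|]; last first.
  split; first exact: asymp_le_trans (entropy_Ikmu_le (leey 1) Lsub sub1) up1.
  (* The lower bound passes from L_2 to L_oo at [gamma = 1], then from [H]_~ to H. *)
  have le12 : asymp_le _ _ := le2y 1 (introT andP (conj beta1 (lexx 1))).
  exact: asymp_le_trans (asymp_le_trans low2 le12)
    (entropy_inclusion_le (leey 1) sub1 complete_mu).
rewrite rateE; have up2g := asymp_le_trans (le2y _ bg) (up _ bg).
(* The covers of index 1 consist of a single ball, and give the continuity of the embeddings. *)
have [cy _ covy] := entropy_rate_covered (up _ bg).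
have [c2 _ cov2] := entropy_rate_covered up2g.
split.
- exact: (covered_continuously_embedded (sub _ bg) (covy 1%N isT)).
- exact: (covered_continuously_embedded (sub2 gamma) (cov2 1%N isT)).
- by split; [exact: asymp_le_trans (up _ bg) (low _ bg)|exact: le2y].
- by split; [exact: up2g|exact: low].
Qed.
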